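(* Let $K$ be an algebraically closed field of characteristic $p > 2$, let $G = \operatorname{Sp}(V)$, where $V$ is a $K$-vector space with a non-degenerate alternating bilinear form and $\dim V = n$ for some $n \geq 4$, and let $\mathfrak{g}$ be the Lie algebra of $G$. Let $e \in \mathfrak{g}$ be a nilpotent element whose Jordan normal form on $V$ has block sizes $d_1, \ldots, d_t$ (counted with multiplicity), where $t \geq 1$ and $d_r \geq 1$ for all $1 \leq r \leq t$. Set $\alpha = \nu_p(\gcd(d_1, \ldots, d_t))$. Let $e_0$ be the action of $e$ on $\wedge^2(V)$, and let $e_0''$ be the action of $e$ on $L_G(\varpi_2)$. Then the Jordan block sizes of $e_0''$ are determined from those of $e_0$ as follows: (iii) If $p \nmid n$, then $r_1(e_0'') = r_1(e_0) - 1$ and $r_m(e_0'') = r_m(e_0)$ for all $m \neq 1$. (iv) If $p \mid n$ and $\alpha = 0$, then $r_1(e_0'') = r_1(e_0) - 2$ and $r_m(e_0'') = r_m(e_0)$ for all $m \neq 1$. (v) If $p \mid n$ and $\alpha > 0$, then $r_{p^{\alpha}}(e_0'') = r_{p^{\alpha}}(e_0) - 2$, $r_{p^{\alpha}-1}(e_0'') = 2$, and $r_m(e_0'') = r_m(e_0)$ for all $m \neq p^{\alpha}, p^{\alpha}-1$.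
   Context: For a nilpotent linear map $f$, $r_m(f)$ is the number of Jordan blocks of size $m$ in the Jordan normal form of $f$ ($m \geq 1$). $\nu_p(a)$ is the largest integer $k \geq 0$ such that $p^k$ divides $a$. $L_G(\lambda)$ denotes the rational irreducible $G$-module of highest weight $\lambda$ (with respect to a fixed maximal torus and base of the root system), and $\varpi_i$ is the $i$-th fundamental dominant weight in the standard Bourbaki labelling; so $V = L_G(\varpi_1)$ is the natural module, and $L_G(\varpi_2)$ is a composition factor of $\wedge^2(V)$. An element $e \in \mathfrak{g}$ acts on a rational $G$-module given by $f: G \to \operatorname{GL}(W)$ via the differential $\mathrm{d} f(e)$. The element $e$ is nilpotent if $\mathrm{d} f(e)$ is nilpotent for every rational representation $f$. *)

(* Defs.v *)
From mathcomp Require Import all_boot all_order all_algebra.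
From mathcomp Require Import mpoly.
From Stdlib Require Import ClassicalEpsilon.

Set Implicit Arguments.
Unset Strict Implicit.
Unset Printing Implicit Defensive.

Import GRing.Theory.
Local Open Scope ring_scope.

Section JordanBlocks.
Variable K : fieldType.

Definition nilpotent_mx (n : nat) (A : 'M[K]_n) : Prop :=
  exists k : nat, iter k (mulmx A) 1%:M = 0.

Definition nil_jordan_block (d : nat) : 'M[K]_d :=
  \matrix_(i < d, j < d) (i.+1 == j)%:R.

Definition nil_jordan_mx (s : seq nat) :
    'M[K]_(\sum_(i < size s) nth 0%N s i) :=
  \mxdiag_(i < size s) nil_jordan_block (nth 0%N s i).

(* A is nilpotent, and s lists with multiplicity, in some order, the sizes of
   the blocks of its Jordan normal form.  The similarity between matrices whose
   dimensions are only propositionally equal is given by inverse rectangular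
   matrices P and Q. *)
Definition jordan_block_sizes (n : nat) (A : 'M[K]_n) (s : seq nat) : Prop :=
  all (fun d => 0 < d)%N s /\
  exists P : 'M[K]_(n, \sum_(i < size s) nth 0%N s i),
  exists Q : 'M[K]_(\sum_(i < size s) nth 0%N s i, n),
    [/\ P *m Q = 1%:M, Q *m P = 1%:M & A = P *m nil_jordan_mx s *m Q].

(* r_m(A).  For nilpotent A the sequence chosen by [epsilon] exists and is
   unique up to permutation; on other matrices the value is irrelevant. *)
Definition num_jordan_blocks (m n : nat) (A : 'M[K]_n) : nat :=
  count_mem m (epsilon (inhabits [::]) (jordan_block_sizes A)).

End JordanBlocks.

Section PolynomialMaps.
Variables (K : fieldType) (n : nat).

(* The variable of index [mxvec_index i j] is the (i, j) coordinate function
   on 'M[K]_n. *)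
Definition mcoord (i j : 'I_n) : {mpoly K[n * n]} := 'X_(mxvec_index i j).

Definition mxeval (p : {mpoly K[n * n]}) (g : 'M[K]_n) : K :=
  p.@[fun k => mxvec g 0 k].

(* The differential of p at the identity matrix, in the direction X. *)
Definition mxdiff1 (p : {mpoly K[n * n]}) (X : 'M[K]_n) : K :=
  \sum_(k < n * n) (p^`M(k)).@[fun l => mxvec 1%:M 0 l] * mxvec X 0 k.

(* The two operations above, entrywise on a matrix of polynomials. *)
Definition poly_map (m : nat) (F : 'M[{mpoly K[n * n]}]_m) (g : 'M[K]_n) :
  'M[K]_m := \matrix_(k, l) mxeval (F k l) g.

Definition differential (m : nat) (F : 'M[{mpoly K[n * n]}]_m) (X : 'M[K]_n) :
  'M[K]_m := \matrix_(k, l) mxdiff1 (F k l) X.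

End PolynomialMaps.

Section Symplectic.
Variables (K : fieldType) (n : nat).

(* The form on V = K^n (column vectors) is (u, v) |-> u^T *m J *m v. *)
Definition alternating_mx (J : 'M[K]_n) : Prop :=
  forall v : 'cV[K]_n, v^T *m J *m v = 0.

Definition nondegenerate_mx (J : 'M[K]_n) : Prop := J \in unitmx.

Definition in_Sp (J g : 'M[K]_n) : Prop := g^T *m J *m g = J.

(* Lie(Sp(V)), as the tangent space at 1 of the subvariety Sp(V) of 'M[K]_n;
   Sp(V) is closed in 'M[K]_n since its elements have determinant 1. *)
Definition in_Lie_Sp (J X : 'M[K]_n) : Prop :=
  forall p : {mpoly K[n * n]},
    (forall g : 'M[K]_n, in_Sp J g -> mxeval p g = 0) -> mxdiff1 p X = 0.

(* A rational representation Sp(V) -> GL_m(K), acting on column vectors.  As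
   Sp(V) is closed in 'M[K]_n, its regular functions are the restrictions of
   polynomials in the matrix entries; F is a choice of such polynomials, and
   [differential F] does not depend on this choice on the Lie algebra. *)
Definition rational_rep (J : 'M[K]_n) (m : nat)
    (F : 'M[{mpoly K[n * n]}]_m) : Prop :=
  poly_map F 1%:M = 1%:M /\
  forall g h : 'M[K]_n, in_Sp J g -> in_Sp J h ->
    poly_map F (g *m h) = poly_map F g *m poly_map F h.

Definition irreducible_rep (J : 'M[K]_n) (m : nat)
    (F : 'M[{mpoly K[n * n]}]_m) : Prop :=
  (0 < m)%N /\
  forall U : {vspace 'cV[K]_m},
    (forall g u, in_Sp J g -> u \in U -> poly_map F g *m u \in U) ->
    U = 0%VS \/ U = fullv.

Definition nilpotent_elt (J X : 'M[K]_n) : Prop :=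
  forall (m : nat) (F : 'M[{mpoly K[n * n]}]_m),
    rational_rep J F -> nilpotent_mx (differential F X).

(* The columns b_0, ..., b_(n-1) of B satisfy (b_i, b_(n-1-i)) = 1 for
   i < n/2, (b_i, b_(n-1-i)) = -1 for i >= n/2, and (b_i, b_j) = 0 otherwise.
   Every pair formed by a maximal torus of Sp(V) and a base of its root system
   comes from such a B: the torus consists of the elements that are diagonal in
   this basis, t b_i = eps_i(t) b_i, and the base is
   eps_0 - eps_1, ..., eps_(l-2) - eps_(l-1), 2 eps_(l-1), where l = n/2. *)
Definition symplectic_basis (J B : 'M[K]_n) : Prop :=
  B^T *m J *m B =
  \matrix_(i, j) (if (i + j == n.-1)%N then (if (i < j)%N then 1 else -1)
                  else 0).

Definition in_torus (J B g : 'M[K]_n) : Prop :=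
  in_Sp J g /\ is_diag_mx (invmx B *m g *m B).

(* The subgroup generated by the root subgroups of the positive roots. *)
Definition in_unipotent (J B g : 'M[K]_n) : Prop :=
  in_Sp J g /\
  forall i j : 'I_n, (j <= i)%N -> (invmx B *m g *m B) i j = (i == j)%:R.

(* A weight is given by its coordinates in eps_0, ..., eps_(l-1), l = n/2. *)
Definition weight_eval (B : 'M[K]_n) (lambda : nat -> int) (t : 'M[K]_n) : K :=
  \prod_(i < n | (i < n./2)%N) (invmx B *m t *m B) i i ^ lambda i.

(* Type C_l in Bourbaki's labelling: varpi_k = eps_0 + ... + eps_(k-1). *)
Definition fundamental_weight (k i : nat) : int := (i < k)%N%:Z.

Definition has_highest_weight (J B : 'M[K]_n) (lambda : nat -> int) (m : nat)
    (F : 'M[{mpoly K[n * n]}]_m) : Prop :=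
  exists w : 'cV[K]_m,
    [/\ w != 0,
        forall u, in_unipotent J B u -> poly_map F u *m w = w &
        forall t, in_torus J B t ->
          poly_map F t *m w = weight_eval B lambda t *: w].

(* F is a matrix form of L_G(lambda), for the torus and base given by B. *)
Definition is_L (J B : 'M[K]_n) (lambda : nat -> int) (m : nat)
    (F : 'M[{mpoly K[n * n]}]_m) : Prop :=
  [/\ rational_rep J F, irreducible_rep J F & has_highest_weight J B lambda F].

End Symplectic.

Section ExteriorSquare.
Variables (K : fieldType) (n : nat).

(* Indexes the basis v_i /\ v_j (i < j) of the exterior square of K^n. *)
Definition ltpair : finType := {ij : 'I_n * 'I_n | (ij.1 < ij.2)%N}.

(* The matrix of g v_i /\ g v_j = \sum_(k < l) (g_ki g_lj - g_kj g_li)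
   v_k /\ v_l, with polynomial entries. *)
Definition ext2 : 'M[{mpoly K[n * n]}]_#|{: ltpair}| :=
  \matrix_(a, b) let: (k, l) := val (enum_val a) in
                 let: (i, j) := val (enum_val b) in
    mcoord K k i * mcoord K l j - mcoord K k j * mcoord K l i.

End ExteriorSquare.

(* Main.v *)
Require Import Defs.
From HB Require Import structures.
From mathcomp Require Import all_boot all_order all_algebra.
From mathcomp Require Import mpoly zify ring.
From Stdlib Require Import ClassicalEpsilon.

Set Implicit Arguments.
Unset Strict Implicit.
Unset Printing Implicit Defensive.

Import GRing.Theory.
Local Open Scope ring_scope.

(** Writing a bivector as [X *m J] with [X] skew-symmetric identifies the exterior
    square of V with the space pp of matrices that are self-adjoint for the form.
    There g in Sp(V) acts by conjugation and e by [ad e], the invariant bivector is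
    the identity matrix and the contraction to K is the trace.

    If w is a highest weight vector of L and f a functional that is fixed by the
    opposite unipotent group, then the matrix coefficient f(g w) is determined up to
    a scalar on the big cell, hence on Sp(V) by density, and so agrees with the
    corresponding matrix coefficient of pp.  This makes L the quotient of
    P0 = pp cap ker tr by the scalars in P0, and the identification is compatible
    with e because the differential at e of a polynomial vanishing on Sp(V) is 0.

    It remains to compare ranks of powers.  Let q = p^alpha and p | n.  Divided
    powers of d/dx on the Jordan blocks give trace zero solutions of
    (ad e)^k S = 1 for 0 < k < q, and projecting onto a Jordan block of e^q gives T
    with (ad e)^q T = 0 and tr T <> 0.  By invariance of the trace form,
    rank e0''^k = rank e0^k - 2 for k < q and rank e0''^k = rank e0^k for k >= q.
    If p does not divide n, the ranks differ for k = 0 only, where they differ by 1.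
    Finally, [e, D] = 1 for some D if alpha > 0, which forces p to divide all block
    sizes of e0, so that e0 has no block of size q - 1. *)

(** * Jordan normal form of a nilpotent matrix *)

(** L is given only by irreducibility and a highest weight vector, so no map between L and pp is
    available at the outset. The comparison is therefore a correspondence: the subspace of pp x L
    spanned by the Sp(V)-orbit of the pair of highest weight vectors. Density of the big cell is
    tested on curves: Sp(V) is generated by transvections, so every g is joined to 1 by a polynomial
    curve inside Sp(V), and there the question concerns polynomials in one variable. The constants 1
    and 2 count losses of rank. L arises from pp by restricting to trace zero and then dividing by
    the scalars. The first operation lowers the rank of the k-th power by one exactly when the
    kernel of (ad e)^k on pp has trace zero, the second exactly when 1 lies in the image of P0. If p
    | n, both happen precisely for k < q; otherwise only the first happens, for k = 0. The
    difference of ranks is thus a step function of k, and numbers of blocks are second differences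
    of ranks. Since p > 2, averaging with the adjoint turns any matrix into a self-adjoint one. *)

Section BlockDiagonal.
Variables (R : pzRingType) (m : nat) (d : 'I_m -> nat).

Lemma mulmx_mxdiag (A B : forall i, 'M[R]_(d i)) :
  \mxdiag_i A i *m \mxdiag_i B i = \mxdiag_i (A i *m B i).
Proof.
rewrite /mxdiag mul_mxdiag_mxblock; apply/eq_mxblock => i j.
case: (eqVneq i j) => [eq_ij|neq_ij]; last by rewrite mulmx0.
by case: j / eq_ij; rewrite !conform_mx_id.
Qed.

Lemma expr_mxdiag (A : forall i, 'M[R]_(d i)) k :
  (\mxdiag_i A i) ^+ k = \mxdiag_i (A i ^+ k).
Proof.
elim: k => [|k IHk]; first by rewrite expr0 -[1]/(1%:M) -mxdiagZ.
rewrite exprS IHk -[_ * _]/(_ *m _) mulmx_mxdiag.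
by apply: eq_mxdiag => i; rewrite exprS.
Qed.
End BlockDiagonal.

Section NilpotentJordan.
Variable K : fieldType.

Lemma iter_mulmx n (A : 'M[K]_n) k : iter k (mulmx A) 1%:M = A ^+ k.
Proof. by elim: k => //= k ->; rewrite exprS. Qed.

Lemma expr_nil_jordan_block d k (i j : 'I_d) :
  (nil_jordan_block K d ^+ k) i j = (i + k == j)%N%:R.
Proof.
elim: k i j => [|k IHk] i j; first by rewrite expr0 mxE addn0.
rewrite exprS mxE.
case: (ltnP i.+1 d) => [lt_id|ge_id]; last first.
  rewrite big1 => [|l _]; last first.
    by rewrite mxE (_ : (_ == _) = false) ?mul0r //; have := ltn_ord l; lia.
  by rewrite (_ : (_ == _) = false) //; have := ltn_ord j; lia.
rewrite (bigD1 (Ordinal lt_id)) //= big1 => [|l neq_l].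
  by rewrite IHk mxE /= eqxx mul1r addr0 addnS addSn.
by rewrite mxE (_ : (_ == _) = false) ?mul0r //; apply: contraNF neq_l => /eqP ?;
  apply/eqP/val_inj.
Qed.

(** The power [N] satisfies [N = pid_mx (d - k) *m N] and [pid_mx (d - k) = N *m N^T], so the two
    ranks bound each other. *)
Lemma rank_expr_nil_jordan_block d k :
  \rank (nil_jordan_block K d ^+ k) = (d - k)%N.
Proof.
pose N := nil_jordan_block K d ^+ k.
have NE i j : N i j = (i + k == j)%N%:R by exact: expr_nil_jordan_block.
have N_pid : N = pid_mx (d - k) *m N.
  apply/matrixP => i j; rewrite mxE (bigD1 i) //= big1 => [|l neq_li].
    rewrite addr0 mxE eqxx /= !NE; have := ltn_ord j; case: eqP; rewrite ?mulr0 //.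
    by move=> <- lt_d; rewrite ltn_subRL addnC lt_d mulr1.
  by rewrite mxE (_ : (_ == _ :> nat) = false) ?mul0r //;
    apply: contraNF neq_li => /eqP ?; apply/eqP/val_inj.
have pid_N : pid_mx (d - k) = N *m N^T.
  apply/matrixP => i j; rewrite !mxE ltn_subRL addnC.
  case: (ltnP (i + k) d) => [lt_d|ge_d]; last first.
    rewrite andbF big1 // => l _; rewrite NE (_ : (_ == _) = false) ?mul0r //.
    by have := ltn_ord l; lia.
  rewrite (bigD1 (Ordinal lt_d)) //= big1 => [|l neq_l].
    by rewrite mxE !NE /= eqxx mul1r addr0 eqn_add2r andbT eq_sym.
  rewrite NE (_ : (_ == _) = false) ?mul0r //.
  by apply: contraNF neq_l => /eqP ?; apply/eqP/val_inj.
have rank_pid : \rank (pid_mx (d - k) : 'M[K]_d) = (d - k)%N.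
  by rewrite rank_pid_mx // leq_subr.
apply/eqP; rewrite eqn_leq; apply/andP; split.
  by rewrite -/N N_pid -[leqRHS]rank_pid mxrankM_maxl.
by rewrite -rank_pid pid_N mxrankM_maxl.
Qed.

Definition simil n m (A : 'M[K]_n) (B : 'M[K]_m) :=
  exists P : 'M[K]_(n, m), exists Q : 'M[K]_(m, n),
    [/\ P *m Q = 1%:M, Q *m P = 1%:M & A = P *m B *m Q].

Lemma simil_trans n m l (A : 'M[K]_n) (B : 'M[K]_m) (C : 'M[K]_l) :
  simil A B -> simil B C -> simil A C.
Proof.
move=> [P [Q [PQ QP ->]]] [P' [Q' [PQ' QP' ->]]].
exists (P *m P'), (Q' *m Q); split; last by rewrite !mulmxA.
  by rewrite mulmxA -(mulmxA P) PQ' mulmx1.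
by rewrite mulmxA -(mulmxA Q') QP mulmx1.
Qed.

Lemma simil_castmx n m (eq_nm : n = m) (A : 'M[K]_n) :
  simil A (castmx (eq_nm, eq_nm) A).
Proof.
case: m / eq_nm; rewrite castmx_id; exists 1%:M, 1%:M.
by rewrite !mulmx1 mul1mx.
Qed.

Lemma simil_sym n m (A : 'M[K]_n) (B : 'M[K]_m) : simil A B -> simil B A.
Proof.
move=> [P [Q [PQ QP ->]]]; exists Q, P; split=> //.
by rewrite !mulmxA QP mul1mx -mulmxA QP mulmx1.
Qed.

Lemma simil_block n m l (A : 'M[K]_n) (B : 'M[K]_m) (C : 'M[K]_l) :
  simil B C -> simil (block_mx A 0 0 B) (block_mx A 0 0 C).
Proof.
move=> [P [Q [PQ QP ->]]].
exists (block_mx 1%:M 0 0 P), (block_mx 1%:M 0 0 Q).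
by rewrite !mulmx_block !(mulmx1, mul1mx, mulmx0, mul0mx, addr0, add0r) PQ QP
     -!scalar_mx_block.
Qed.

Lemma simil_nil_jordan_cons k s :
  simil (nil_jordan_mx K (k :: s))
        (block_mx (nil_jordan_block K k) 0 0 (nil_jordan_mx K s)).
Proof.
rewrite /nil_jordan_mx mxdiag_recl /=.
exact/simil_sym/simil_castmx.
Qed.

Lemma simil_expr n m (A : 'M[K]_n) (B : 'M[K]_m) P Q :
  Q *m P = 1%:M -> P *m Q = 1%:M -> A = P *m B *m Q ->
  forall k, A ^+ k = P *m B ^+ k *m Q.
Proof.
move=> QP PQ -> ; elim=> [|k IHk]; first by rewrite !expr0 mulmx1 PQ.
rewrite !exprS IHk; set X := B ^+ k.
rewrite -[B * X]/(B *m X) -[LHS]/((P *m B *m Q) *m (P *m X *m Q)).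
by rewrite -!mulmxA (mulmxA Q) QP mul1mx.
Qed.

(* Splits off one block of maximal size [k]: [C] has the rows [v A^i] and [R]
   the columns [A^(k-1-j) l], where [v A^(k-1) l <> 0]; then [C R] is triangular
   and invertible, and [kermx R] is an invariant complement of [C]. *)
Lemma nilpotent_split n (A : 'M[K]_n) k (r c : 'I_n) :
  A ^+ k.+1 = 0 -> (A ^+ k) r c != 0 ->
  exists (m : nat) (A' : 'M[K]_m),
    [/\ (m < n)%N, A' ^+ k.+1 = 0 &
        simil A (block_mx (nil_jordan_block K k.+1) 0 0 A')].
Proof.
move=> Ak0 Ark.
pose C : 'M[K]_(k.+1, n) := \matrix_(i < k.+1) row r (A ^+ i).
pose R : 'M[K]_(n, k.+1) := \matrix_(i < n, j < k.+1) (A ^+ (k - j)) i c.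
pose N := nil_jordan_block K k.+1.
have CR i j : (C *m R) i j = (A ^+ (i + (k - j))) r c.
  rewrite mxE exprD -[_ * _]/(_ *m _) mxE.
  by apply: eq_bigr => l _; rewrite !mxE.
have Age l : (k < l)%N -> A ^+ l = 0.
  by move=> lt_kl; rewrite -(subnK lt_kl) exprD Ak0 mulr0.
have CRu : C *m R \in unitmx.
  rewrite -unitmx_tr unitmxE det_trig.
    rewrite unitfE; apply/prodf_neq0 => i _; rewrite mxE CR subnKC //.
    by rewrite -ltnS.
  apply/is_trig_mxP => i j lt_ij; rewrite mxE CR Age ?mxE //.
  by have := ltn_ord i; have := ltn_ord j; lia.
pose X := invmx (C *m R).
have XCR : X *m (C *m R) = 1%:M by exact: mulVmx.
have CRX : C *m R *m X = 1%:M by exact: mulmxV.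
have CA : C *m A = N *m C.
  apply/row_matrixP => i; rewrite row_mul rowK -row_mul -[_ *m A]/(_ * A) -exprSr.
  rewrite row_mul; case: (ltnP i.+1 k.+1) => [lt_ik|ge_ik].
    have -> : row i N = delta_mx 0 (Ordinal lt_ik).
      by apply/rowP => j; rewrite !mxE /= eq_sym.
    by rewrite -rowE rowK.
  rewrite Age // row0 (_ : row i N = 0) ?mul0mx //.
  apply/rowP => j; rewrite !mxE (_ : (_ == _) = false) //.
  by have := ltn_ord j; lia.
have AR : A *m R = R *m N.
  apply/matrixP => i j; have -> : (A *m R) i j = (A ^+ (k - j).+1) i c.
    by rewrite exprS -[_ * _]/(_ *m _) !mxE; apply: eq_bigr => l _; rewrite !mxE.
  rewrite mxE; case: (posnP j) => [j0|j_gt0].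
    rewrite j0 subn0 Ak0 mxE big1 // => l _; rewrite !mxE j0 mulr0 //.
  have lt_j1 : (j.-1 < k.+1)%N by have := ltn_ord j; lia.
  rewrite (bigD1 (Ordinal lt_j1)) //= big1 => [|l neq_l].
    rewrite addr0 !mxE /= prednK // eqxx mulr1.
    by rewrite (_ : (k - j.-1)%N = (k - j).+1) //; have := ltn_ord j; lia.
  rewrite !mxE (_ : (_ == _) = false) ?mulr0 //.
  by apply: contraNF neq_l => /eqP def_j; apply/eqP/val_inj; rewrite /= -def_j.
pose D := row_base (kermx R).
have D_free : row_free D by exact: row_base_free.
have D_ker p (W : 'M_(p, n)) : W *m R = 0 -> (W <= D)%MS.
  by move=> WR; rewrite eq_row_base; apply/sub_kermxP.
have DR : D *m R = 0 by apply/sub_kermxP; rewrite eq_row_base.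
(* [Z] projects onto the kernel of [R] along the rows of [C]. *)
pose Z := 1%:M - R *m X *m C.
have ZR : Z *m R = 0 by rewrite mulmxBl mul1mx -!mulmxA XCR mulmx1 subrr.
have CZ : C *m Z = 0 by rewrite mulmxBr mulmx1 !mulmxA CRX mul1mx subrr.
have DZ : D *m Z = D by rewrite mulmxBr mulmx1 !mulmxA DR !mul0mx subr0.
have [W DW WD] : exists2 W, D *m W = 1%:M &
    forall p (U : 'M_(p, n)), (U <= D)%MS -> U *m W *m D = U.
  by exists (pinvmx D); [exact: mulmxVp | move=> p U; exact: mulmxKpV].
pose A' := D *m A *m W.
have A'D : A' *m D = D *m A.
  by rewrite WD // D_ker // -mulmxA AR mulmxA DR mul0mx.
pose Q := col_mx C D; pose P := row_mx (R *m X) (Z *m W).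
have PQ : P *m Q = 1%:M.
  by rewrite mul_row_col WD ?D_ker // addrC subrK.
have QP : Q *m P = 1%:M.
  rewrite mul_col_row !mulmxA CRX CZ DZ DR !mul0mx DW.
  by rewrite -scalar_mx_block.
exists (\rank (kermx R)), A'; split.
- have rR : \rank R = k.+1.
    apply/eqP; rewrite eqn_leq rank_leq_col -{1}(mxrank_unit CRu).
    exact: mxrankM_maxr.
  by rewrite mxrank_ker rR; have := rank_leq_row R; rewrite rR; lia.
- apply: (row_free_inj D_free); rewrite mul0mx.
  suff -> l : A' ^+ l *m D = D *m A ^+ l by rewrite Ak0 mulmx0.
  elim: l => [|l IHl]; first by rewrite !expr0 mulmx1 mul1mx.
  rewrite exprSr exprSr -[_ * A']/(_ *m _) -[_ * A]/(_ *m _).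
  by rewrite -mulmxA A'D mulmxA IHl mulmxA.
- exists P, Q; split => //.
  rewrite -mulmxA mul_block_col !mul0mx addr0 add0r A'D -CA -mul_col_mx mulmxA.
  by rewrite PQ mul1mx.
Qed.

(** Induction on the dimension: a nonzero entry of the last nonzero power of A splits off a block of
    maximal size. *)
Lemma nilpotent_jordan n (A : 'M[K]_n) :
  nilpotent_mx A -> exists s, jordan_block_sizes A s.
Proof.
case=> k; rewrite iter_mulmx.
elim/ltn_ind: n => n IHn in A k * => Ak.
case: n => [|n] in A IHn Ak *.
  have sum0 : (\sum_(i < size (Nil nat)) nth 0%N [::] i = 0)%N by rewrite big_ord0.
  exists [::]; split=> //; exists 0, 0; split;
    [| |by rewrite [LHS]flatmx0 [RHS]flatmx0].
    by rewrite [LHS]flatmx0 [RHS]flatmx0.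
  by apply/matrixP => -[i lt_i]; exfalso; move: lt_i; rewrite sum0.
have [k0 /eqP Ak0 min_k] : exists2 k0, A ^+ k0 == 0 & forall j,
  A ^+ j == 0 -> (k0 <= j)%N.
  have exk : exists j, A ^+ j == 0 by exists k; apply/eqP.
  by case: (ex_minnP exk) => k0; exists k0.
case: k0 => [|k0] in Ak0 min_k.
  by move/matrixP/(_ 0 0)/eqP: Ak0; rewrite expr0 !mxE oner_eq0.
have : A ^+ k0 != 0 by apply: contraTN (leqnn k0.+1) => /min_k; rewrite -leqNgt.
case/matrix0Pn => r [c Arc].
have [m [A' [lt_mn A'k0 simA]]] := nilpotent_split Ak0 Arc.
have [s [s_gt0 simA']] := IHn _ lt_mn _ _ A'k0.
exists (k0.+1 :: s); split; first by [].
apply: simil_trans simA _; apply: simil_trans (simil_block _ simA') _.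
exact/simil_sym/simil_nil_jordan_cons.
Qed.

Lemma rank_jordan n (A : 'M[K]_n) s k :
  jordan_block_sizes A s -> \rank (A ^+ k) = (\sum_(x <- s) (x - k))%N.
Proof.
move=> [_ [P [Q [PQ QP defA]]]].
have freeQ : row_free Q by apply/row_freeP; exists P.
have fullP : row_full P by apply/row_fullP; exists Q.
rewrite (simil_expr QP PQ defA) mxrankMfree // (eqmxMfull _ fullP).
rewrite /nil_jordan_mx expr_mxdiag rank_mxdiag (big_nth 0%N) big_mkord.
by apply: eq_bigr => i _; rewrite rank_expr_nil_jordan_block.
Qed.

(** Termwise: with truncated subtraction, k -> a - k bends only at k = a, where its second
    difference is 1. *)
Lemma count_mem_ranks (s : seq nat) m : (0 < m)%N ->
  (count_mem m s + 2 * \sum_(x <- s) (x - m) =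
   \sum_(x <- s) (x - m.-1) + \sum_(x <- s) (x - m.+1))%N.
Proof.
move=> m_gt0; elim: s => [|a s IHs]; first by rewrite !big_nil.
rewrite !big_cons /=; move: IHs; move: (count _ _) => u.
move: (\sum_(x <- s) (x - m))%N (\sum_(x <- s) (x - m.-1))%N => v w.
by move: (\sum_(x <- s) (x - m.+1))%N => z; case: eqP; lia.
Qed.

(** This makes the count independent of the list that [epsilon] picks. *)
Lemma num_jordan_blocks_ranks n (A : 'M[K]_n) m : nilpotent_mx A -> (0 < m)%N ->
  (num_jordan_blocks m A + 2 * \rank (A ^+ m) =
   \rank (A ^+ m.-1) + \rank (A ^+ m.+1))%N.
Proof.
move=> /nilpotent_jordan exs m_gt0; rewrite /num_jordan_blocks.
have := epsilon_spec (inhabits [::]) _ exs; set s := epsilon _ _ => s_A.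
by rewrite !(rank_jordan _ s_A) count_mem_ranks.
Qed.

End NilpotentJordan.

(** * Commutators with a nilpotent matrix *)

Definition ad (R : pzRingType) n (e X : 'M[R]_n) : 'M[R]_n := e *m X - X *m e.

Lemma sum_multiples q c : (0 < q)%N -> (\sum_(i < q * c) (q %| i) = c)%N.
Proof.
move=> q_gt0; elim: c => [|c IHc]; first by rewrite muln0 big_ord0.
rewrite mulnS -(big_mkord xpredT (fun i => q %| i : nat)) addnC.
rewrite (big_cat_nat (n := q * c)) ?leq_addr //= big_mkord IHc.
rewrite -{1}[(q * c)%N]add0n big_addn addKn -addn1; congr (_ + _)%N.
rewrite (bigD1_seq 0%N) ?mem_index_iota ?iota_uniq //= add0n dvdn_mulr //.
rewrite big1_seq // => i; rewrite mem_index_iota => /andP[i_neq0 /andP[_ lt_iq]].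
by rewrite addnC dvdn_addr ?dvdn_mulr // gtnNdvd // lt0n.
Qed.

Section AdjointJordan.
Variable K : fieldType.

(** k C(d, k) = d C(d - 1, k - 1) is divisible by p^a; if p did not divide C(d, k), then p^a would
    divide k, which is smaller. *)
Lemma bin_pchar_eq0 p a d k : p \in [pchar K] -> (p ^ a %| d)%N ->
  (0 < k < p ^ a)%N -> 'C(d, k)%:R = 0 :> K.
Proof.
move=> charK dvd_d /andP[k_gt0 lt_k]; apply/eqP; rewrite -(dvdn_pcharf charK).
apply: contraLR lt_k => ndvd_C; rewrite -leqNgt dvdn_leq //.
rewrite -(Gauss_dvdl _ (_ : coprime (p ^ a) 'C(d, k))).
  case: k k_gt0 {ndvd_C} => // k _.
  by rewrite -mul_bin_diag dvdn_mulr.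
by rewrite coprimeXl // prime_coprime // (pcharf_prime charK).
Qed.

(* The matrix of the k-th divided power of d/dx on K[x] / (x^d). *)
Definition divided_power_mx d k : 'M[K]_d :=
  \matrix_(i, j) ((i == j + k :> nat)%N%:R * 'C(i, k)%:R).

(** Pascal's rule, entry by entry. The last row of the shift is zero, so there the rule requires
    C(d, k + 1) = 0 in K; this is where divisibility of d enters. In the first column the absent
    term is C(k, k + 1) = 0. *)
Lemma ad_divided_power p a d k : p \in [pchar K] -> (p ^ a %| d)%N ->
  (k.+1 < p ^ a)%N ->
  ad (nil_jordan_block K d) (divided_power_mx d k.+1) = divided_power_mx d k.
Proof.
move=> charK dvd_d lt_k; apply/matrixP => i j; rewrite !mxE.
have -> : \sum_l nil_jordan_block K d i l * divided_power_mx d k.+1 l j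
    = (i == j + k :> nat)%N%:R * 'C(i.+1, k.+1)%:R.
  case: (ltnP i.+1 d) => [lt_id|ge_id].
    rewrite (bigD1 (Ordinal lt_id)) //= big1 => [|l neq_l].
      by rewrite !mxE /= eqxx mul1r addr0 addnS eqSS.
    rewrite !mxE (_ : (_ == _) = false) ?mul0r //.
    by apply: contraNF neq_l => /eqP ?; apply/eqP/val_inj.
  have -> : i.+1 = d by have := ltn_ord i; lia.
  rewrite (bin_pchar_eq0 charK dvd_d) // mulr0 big1 // => l _.
  rewrite !mxE (_ : (_ == _) = false) ?mul0r //.
  by have := ltn_ord l; lia.
have -> : \sum_l divided_power_mx d k.+1 i l * nil_jordan_block K d l j
    = (i == j + k :> nat)%N%:R * 'C(i, k.+1)%:R.
  case: (posnP j) => [j0|j_gt0].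
    rewrite big1 => [|l _]; last by rewrite !mxE j0 mulr0.
    by rewrite j0 add0n; case: eqP => [->|_]; rewrite ?mul0r // bin_small ?mulr0.
  have lt_jd : (j.-1 < d)%N by have := ltn_ord j; lia.
  rewrite (bigD1 (Ordinal lt_jd)) //= big1 => [|l neq_l].
    by rewrite !mxE /= prednK // eqxx mulr1 addr0 addnS -addSn prednK.
  rewrite !mxE (_ : (l.+1 == _) = false) ?mulr0 //.
  by apply: contraNF neq_l => /eqP def_j; apply/eqP/val_inj; rewrite /= -def_j.
by rewrite binS natrD -mulrBr [X in X - _]addrC addrK.
Qed.

Lemma divided_power0 d : divided_power_mx d 0 = 1%:M.
Proof. by apply/matrixP => i j; rewrite !mxE bin0 mulr1 addn0. Qed.

Lemma tr_divided_power d k : (0 < k)%N -> \tr (divided_power_mx d k) = 0.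
Proof.
move=> k_gt0; rewrite /mxtrace big1 // => i _.
by rewrite mxE (_ : (_ == _) = false) ?mul0r //; lia.
Qed.

Lemma iter_ad_divided_power p a d k : p \in [pchar K] -> (p ^ a %| d)%N ->
  (k < p ^ a)%N ->
  iter k (ad (nil_jordan_block K d)) (divided_power_mx d k) = 1%:M.
Proof.
move=> charK dvd_d; elim: k => [|k IHk] lt_k; first exact: divided_power0.
by rewrite iterSr (ad_divided_power charK dvd_d) // IHk // ltnW.
Qed.

Lemma jordan_ad_one p a n (e : 'M[K]_n) d k : p \in [pchar K] ->
  jordan_block_sizes e d -> all (fun x => p ^ a %| x)%N d -> (k < p ^ a)%N ->
  exists2 S : 'M[K]_n, iter k (ad e) S = 1%:M & ((0 < k)%N -> \tr S = 0).
Proof.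
move=> charK [_ [P [Q [PQ QP ->]]]] /allP dvd_d lt_k.
have dvd_nth (i : 'I_(size d)) : (p ^ a %| nth 0%N d i)%N by rewrite dvd_d ?mem_nth.
exists (P *m \mxdiag_i (divided_power_mx (nth 0%N d i) k) *m Q); last first.
  move=> k_gt0; rewrite mxtrace_mulC mulmxA QP mul1mx mxtrace_mxdiag.
  by rewrite big1 // => i _; rewrite tr_divided_power.
have ad_sim (X : forall i : 'I_(size d), 'M[K]_(nth 0%N d i)) :
  ad (P *m nil_jordan_mx K d *m Q) (P *m \mxdiag_i X i *m Q)
  = P *m \mxdiag_i (ad (nil_jordan_block K _) (X i)) *m Q.
  rewrite /ad mxdiagB -!mulmx_mxdiag mulmxBr mulmxBl.
  by rewrite -!mulmxA !(mulmxA Q) QP !mul1mx !mulmxA.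
have -> (X : forall i : 'I_(size d), 'M[K]_(nth 0%N d i)) :
  iter k (ad (P *m nil_jordan_mx K d *m Q)) (P *m \mxdiag_i X i *m Q)
  = P *m \mxdiag_i (iter k (ad (nil_jordan_block K _)) (X i)) *m Q.
  elim: k {lt_k} => //= k ->; exact: ad_sim.
rewrite (eq_mxdiag (fun i => iter_ad_divided_power charK (dvd_nth i) lt_k)).
by rewrite mxdiagZ mulmx1.
Qed.

(* T is the projection of the i-th block onto one of the q blocks of equal size
   into which it falls apart under e^q. *)
Lemma jordan_commuting_trace q n (e : 'M[K]_n) d x : (0 < q)%N ->
  jordan_block_sizes e d -> x \in d -> (q %| x)%N ->
  exists2 T : 'M[K]_n, T *m e ^+ q = e ^+ q *m T & \tr T = (x %/ q)%:R.
Proof.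
move=> q_gt0 [_ [P [Q [PQ QP def_e]]]] /(nthP 0%N)[i0 lt_i0 def_x] dvd_x.
pose i := Ordinal lt_i0.
pose T (j : 'I_(size d)) : 'M[K]_(nth 0%N d j) :=
  if j == i then diag_mx (\row_r (q %| r)%N%:R) else 0.
exists (P *m \mxdiag_j T j *m Q).
  rewrite (simil_expr QP PQ def_e) -!mulmxA !(mulmxA Q) QP !mul1mx.
  rewrite (mulmxA (mxdiag _)) (mulmxA (_ ^+ _)); congr (_ *m (_ *m _)).
  rewrite expr_mxdiag !mulmx_mxdiag; apply: eq_mxdiag => j.
  rewrite /T; case: eqP => _; last by rewrite mul0mx mulmx0.
  apply/matrixP => r s; rewrite mul_diag_mx mul_mx_diag !mxE.
  rewrite expr_nil_jordan_block; case: eqP => [<-|_]; last by rewrite mulr0 mul0r.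
  by rewrite dvdn_addl // mulrC.
rewrite mxtrace_mulC mulmxA QP mul1mx mxtrace_mxdiag (bigD1 i) //= big1.
  rewrite addr0 /T eqxx mxtrace_diag.
  under eq_bigr do rewrite mxE.
  rewrite -natr_sum /= def_x.
  by have := sum_multiples (x %/ q) q_gt0; rewrite mulnC divnK // => ->.
by move=> j /negPf neq_ji; rewrite /T neq_ji mxtrace0.
Qed.

Lemma tr_mul_ad n (e A B : 'M[K]_n) : \tr (A *m ad e B) = - \tr (ad e A *m B).
Proof.
rewrite /ad mulmxBr mulmxBl !linearB /= opprB !mulmxA.
by rewrite [\tr (A *m B *m e)]mxtrace_mulC mulmxA.
Qed.

(** The projection T onto a block of size x (the case q = 1 of [jordan_commuting_trace]) commutes
    with A, hence x = tr (T [A, D]) = - tr ([A, T] D) = 0 in K. *)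
Lemma dvdn_jordan_block p n (A D : 'M[K]_n) s x : p \in [pchar K] ->
  jordan_block_sizes A s -> ad A D = 1%:M -> x \in s -> (p %| x)%N.
Proof.
move=> charK s_A AD s_x.
have [|T + trT] := jordan_commuting_trace (ltn0Sn 0) s_A s_x; first exact: dvd1n.
rewrite expr1 divn1 in trT * => TA.
rewrite (dvdn_pcharf charK) -trT -[T]mulmx1 -AD tr_mul_ad.
by rewrite /ad TA subrr mul0mx mxtrace0 oppr0.
Qed.

Lemma num_jordan_blocks_eq0 p n (A D : 'M[K]_n) m : p \in [pchar K] ->
  nilpotent_mx A -> ad A D = 1%:M -> ~~ (p %| m)%N -> num_jordan_blocks m A = 0%N.
Proof.
move=> charK /nilpotent_jordan exs AD; rewrite /num_jordan_blocks.
have := epsilon_spec (inhabits [::]) _ exs; set s := epsilon _ _ => s_A ndvd_m.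
by apply/count_memPn; apply: contra ndvd_m; exact: dvdn_jordan_block s_A AD.
Qed.

End AdjointJordan.

(** * Polynomial functions of a matrix and their differentials *)

Section PolynomialMatrices.
Variables (K : fieldType) (n : nat).
Implicit Types (p q : {mpoly K[n * n]}) (g X : 'M[K]_n).

Lemma mxeval_mcoord i j g : mxeval (mcoord K i j) g = g i j.
Proof. by rewrite /mxeval mevalXU mxvecE. Qed.

Lemma mxeval_sum (I : Type) (r : seq I) (F : I -> {mpoly K[n * n]}) g :
  mxeval (\sum_(i <- r) F i) g = \sum_(i <- r) mxeval (F i) g.
Proof. by rewrite /mxeval raddf_sum. Qed.

Lemma mxdiff1B p q X : mxdiff1 (p - q) X = mxdiff1 p X - mxdiff1 q X.
Proof.
rewrite /mxdiff1 -sumrB; apply: eq_bigr => k _.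
by rewrite mderivB mevalB mulrBl.
Qed.

Lemma mxdiff1D p q X : mxdiff1 (p + q) X = mxdiff1 p X + mxdiff1 q X.
Proof.
rewrite /mxdiff1 -big_split; apply: eq_bigr => k _ /=.
by rewrite mderivD mevalD mulrDl.
Qed.

Lemma mxdiff1Z c p X : mxdiff1 (c *: p) X = c * mxdiff1 p X.
Proof.
rewrite /mxdiff1 mulr_sumr; apply: eq_bigr => k _.
by rewrite mderivZ mevalZ mulrA.
Qed.

Lemma mxdiff1C c X : mxdiff1 c%:MP X = 0.
Proof. by rewrite /mxdiff1 big1 // => k _; rewrite mderivC meval0 mul0r. Qed.

Lemma mxdiff1_sum (I : Type) (r : seq I) (F : I -> {mpoly K[n * n]}) X :
  mxdiff1 (\sum_(i <- r) F i) X = \sum_(i <- r) mxdiff1 (F i) X.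
Proof.
elim: r => [|i r IHr]; first by rewrite !big_nil -[0]/(0%:MP) mxdiff1C.
by rewrite !big_cons mxdiff1D IHr.
Qed.

Lemma mxdiff1M p q X :
  mxdiff1 (p * q) X = mxdiff1 p X * mxeval q 1%:M + mxeval p 1%:M * mxdiff1 q X.
Proof.
rewrite /mxdiff1 mulr_suml mulr_sumr -big_split; apply: eq_bigr => k _ /=.
by rewrite mderivM mevalD !mevalM /mxeval; ring.
Qed.

Lemma mxdiff1_mcoord i j X : mxdiff1 (mcoord K i j) X = X i j.
Proof.
rewrite /mxdiff1 (bigD1 (mxvec_index i j)) //= big1 => [|k neq_k].
  have UU0 : (U_(mxvec_index i j) - U_(mxvec_index i j) = 0 :> 'X_{1..n * n})%MM.
    by apply/mnmP => l; rewrite mnmBE subnn mnm0E.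
  by rewrite mderivX mnm1E eqxx UU0 scale1r mpolyX0 meval1 mul1r mxvecE addr0.
by rewrite mderivX mnm1E eq_sym (negPf neq_k) mulr0n scale0r meval0 mul0r.
Qed.

Definition mpoly_curve p (G : 'M[{poly K}]_n) : {poly K} :=
  mmap (@polyC K) (fun k => mxvec G 0 k) p.

Lemma mpoly_curveE p (G : 'M[{poly K}]_n) s :
  (mpoly_curve p G).[s] = mxeval p (map_mx (horner_eval s) G).
Proof.
rewrite /mpoly_curve.
rewrite /mxeval /meval /mmap -horner_evalE raddf_sum; apply: eq_bigr => m _ /=.
rewrite horner_evalE hornerM hornerC; congr (_ * _).
rewrite /mmap1 horner_prod; apply: eq_bigr => k _.
by rewrite horner_exp -map_mxvec mxE.
Qed.

End PolynomialMatrices.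

(** The product f = q r has only zero values. If f were not zero it would be nonconstant, and a root
    of f + 1 would give 1 = 0. *)
Lemma poly_closed_eq0 (K : closedFieldType) (q r : {poly K}) :
  r != 0 -> (forall s, r.[s] != 0 -> q.[s] = 0) -> q = 0.
Proof.
move=> r_neq0 q0; apply/eqP; apply: contraT => q_neq0.
pose f := q * r; have f_neq0 : f != 0 by rewrite mulf_neq0.
have f0 s : f.[s] = 0.
  rewrite hornerM; have [->|] := eqVneq r.[s] 0; first by rewrite mulr0.
  by move/q0 => ->; rewrite mul0r.
have [/eqP/size_poly1P[c c_neq0 def_f]|size_f] := eqVneq (size f) 1%N.
  by move: (f0 0); rewrite def_f hornerC => /eqP; rewrite (negPf c_neq0).
have size_f1 : size (f + 1) = size f.
  by rewrite size_polyDl // size_poly1; move: size_f f_neq0; rewrite -size_poly_eq0;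
    lia.
have /closed_rootP[s /rootP] : size (f + 1) != 1%N by rewrite size_f1.
by rewrite hornerD f0 hornerC add0r => /eqP; rewrite oner_eq0.
Qed.

(** * Symplectic transvections *)

Section Transvections.
Variables (K : fieldType) (n : nat) (J : 'M[K]_n).
Hypotheses (J_alt : alternating_mx J) (J_nondeg : nondegenerate_mx J).
Implicit Types (u v x : 'cV[K]_n) (g h : 'M[K]_n).

Definition bform u v : K := (u^T *m J *m v) 0 0.

Lemma mulmx_bform u v : u^T *m J *m v = (bform u v)%:M.
Proof. exact: mx11_scalar. Qed.

Lemma alternating_tr (A : 'M[K]_n) : alternating_mx A -> A^T = - A.
Proof.
move=> altA; apply/matrixP => i j; rewrite !mxE.
have Aij k l : A k l = ((delta_mx k 0 : 'cV_n)^T *m A *m (delta_mx l 0 : 'cV_n)) 0 0.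
  by rewrite trmx_delta -rowE -colE !mxE.
apply/eqP; rewrite -addr_eq0.
have := altA (delta_mx i 0 + delta_mx j 0) => /matrixP/(_ 0 0).
rewrite [(_ + _)^T]linearD /= !mulmxDl !mulmxDr !altA add0r addr0.
by rewrite mxE -!Aij mxE addrC => ->.
Qed.

Lemma J_tr : J^T = - J. Proof. exact: alternating_tr. Qed.

Lemma bform_alt u : bform u u = 0. Proof. by rewrite /bform J_alt mxE. Qed.

Lemma bformC u v : bform u v = - bform v u.
Proof.
rewrite /bform -[u^T *m J *m v]trmxK mxE !trmx_mul trmxK J_tr.
by rewrite mulNmx mulmxN mxE mulmxA.
Qed.

Lemma bformDr u v w : bform u (v + w) = bform u v + bform u w.
Proof. by rewrite /bform mulmxDr mxE. Qed.

Lemma bformZr u c v : bform u (c *: v) = c * bform u v.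
Proof. by rewrite /bform -scalemxAr mxE. Qed.

Lemma bformBr u v w : bform u (v - w) = bform u v - bform u w.
Proof. by rewrite -scaleN1r bformDr bformZr mulN1r. Qed.

Lemma bformBl u v w : bform (v - w) u = bform v u - bform w u.
Proof. by rewrite bformC bformBr opprB (bformC v) (bformC w) opprK addrC. Qed.

Lemma bform_Sp g u v : in_Sp J g -> bform (g *m u) (g *m v) = bform u v.
Proof.
move=> Jg; rewrite /bform trmx_mul.
by rewrite -!mulmxA (mulmxA J) (mulmxA g^T) mulmxA (mulmxA _ J) Jg mulmxA.
Qed.

Lemma bform_nondeg v : v != 0 -> exists u, bform v u != 0.
Proof.
move=> v_neq0; have : v^T *m J != 0.
  apply: contra_neq v_neq0 => vJ0; apply/trmx_inj; rewrite trmx0.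
  by rewrite -[v^T](mulmxK J_nondeg) vJ0 mul0mx.
case/matrix0Pn => i [j]; rewrite (ord1 i) => vJj.
by exists (delta_mx j 0); rewrite /bform -colE mxE.
Qed.

Lemma Sp1 : in_Sp J 1%:M. Proof. by rewrite /in_Sp trmx1 mul1mx mulmx1. Qed.

Lemma SpM g h : in_Sp J g -> in_Sp J h -> in_Sp J (g *m h).
Proof.
by move=> Jg Jh; rewrite /in_Sp trmx_mul -!mulmxA (mulmxA _ J) (mulmxA _ g) Jg mulmxA.
Qed.

(* The adjoint of g for the form; on Sp(V) it is the inverse, but polynomial in g. *)
Definition form_adj g := invmx J *m g^T *m J.

Lemma form_adj_mulmx g : in_Sp J g -> form_adj g *m g = 1%:M.
Proof. by move=> Jg; rewrite /form_adj -!mulmxA (mulmxA g^T) Jg mulVmx. Qed.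

Lemma mulmx_form_adj g : in_Sp J g -> g *m form_adj g = 1%:M.
Proof. by move/form_adj_mulmx/mulmx1C. Qed.

Lemma SpV g : in_Sp J g -> in_Sp J (form_adj g).
Proof.
move=> Jg; rewrite /in_Sp -{1}Jg -!mulmxA mulmx_form_adj // mulmx1 mulmxA -trmx_mul.
by rewrite mulmx_form_adj // trmx1 mul1mx.
Qed.

Definition transvection v (a : K) : 'M[K]_n := 1%:M + a *: (v *m (v^T *m J)).

Lemma transvection_apply v a x : transvection v a *m x = x + (a * bform v x) *: v.
Proof.
rewrite mulmxDl mul1mx -scalemxAl -mulmxA mulmx_bform mul_mx_scalar.
by rewrite scalerA.
Qed.

Lemma sqr_transvection v : v *m (v^T *m J) *m (v *m (v^T *m J)) = 0.
Proof. by rewrite -!mulmxA (mulmxA v^T J) (mulmxA (v^T *m J)) J_alt mul0mx mulmx0. Qed.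

Lemma transvectionN v a : transvection v a *m transvection v (- a) = 1%:M.
Proof.
rewrite mulmxDl mul1mx mulmxDr mulmx1 -scalemxAl -scalemxAr sqr_transvection.
by rewrite !scaler0 addr0 -addrA scaleNr addNr addr0.
Qed.

Lemma transvection_Sp v a : in_Sp J (transvection v a).
Proof.
rewrite /in_Sp /transvection [(_ + _)^T]linearD /= trmx1 [(_ *: _)^T]linearZ /=
  !trmx_mul trmxK J_tr.
rewrite mulmxDl mul1mx mulmxDr mulmx1 mulmxDl -!scalemxAl -!scalemxAr !mulNmx.
have -> : J *m v *m v^T *m J *m (v *m (v^T *m J)) = 0.
  by rewrite -!mulmxA (mulmxA v^T J) (mulmxA (v^T *m J)) J_alt mul0mx !mulmx0.
by rewrite oppr0 !scaler0 addr0 -addrA !mulmxA scalerN addNr addr0.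
Qed.

(* The row space of (t g - 1) lies in that of (g - 1), and t g fixes u. *)
Lemma transvection_rank_lt g u : in_Sp J g -> bform u (g *m u) != 0 ->
  exists v a, (\rank (transvection v a *m g - 1%:M)%R < \rank (g - 1%:M)%R)%N.
Proof.
(* The transvection along g u - u with this coefficient carries g u back to u. *)
move=> Jg ugu; pose v := g *m u - u; pose a := (bform u (g *m u))^-1.
exists v, a; set tg := _ *m g.
have vJg : v^T *m J *m g = - (u^T *m J *m (g - 1%:M)).
  rewrite /v linearB /= trmx_mul !mulmxBl -!mulmxA (mulmxA g^T) Jg.
  by rewrite mulmxBr mulmx1 mulmxBr opprB.
have def_tg : tg - 1%:M = (1%:M - a *: (v *m u^T *m J)) *m (g - 1%:M).
  rewrite /tg /transvection mulmxDl mul1mx addrAC -scalemxAl -(mulmxA v) vJg mulmxN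
    scalerN.
  by rewrite [RHS]mulmxBl mul1mx -scalemxAl !mulmxA.
have tgu : (tg - 1%:M) *m u = 0.
  rewrite mulmxBl mul1mx -mulmxA transvection_apply.
  rewrite (_ : bform v (g *m u) = - bform u (g *m u)) ?mulrN ?mulVf //.
    by rewrite scaleN1r addrAC subrr.
  by rewrite bformBl bform_alt sub0r.
have v_neq0 : (g - 1%:M) *m u != 0.
  apply: contraNneq ugu; rewrite mulmxBl mul1mx => /eqP; rewrite subr_eq0.
  by move=> /eqP ->; rewrite bform_alt.
apply: rank_ltmx; rewrite ltmxE {1}def_tg submxMl /=.
apply: contra v_neq0 => /submxP[D ->].
by rewrite -mulmxA tgu mulmx0.
Qed.

(** If (u, g u) = 0 for all u, then g is self-adjoint as well as symplectic, so g^2 = 1 and g is -1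
    on w = (g - 1) x. A transvection t along w then gives (u, t g u) = (w, u)^2, nonzero for some u,
    and does not enlarge the row space of g - 1. In the other case one of the two transvections is
    trivial. *)
Lemma transvection_rank_lt_neq1 g : in_Sp J g -> g != 1%:M ->
  exists v a w b, (\rank (transvection v a *m (transvection w b *m g) - 1%:M)%R
                   < \rank (g - 1%:M)%R)%N.
Proof.
move=> Jg g_neq1.
have [[u ugu]|alt_g] := classic (exists u, bform u (g *m u) != 0).
  have [v [a lt_va]] := transvection_rank_lt Jg ugu.
  exists v, a, 0, 0; rewrite {2}/transvection scale0r addr0 mul1mx.
  exact: lt_va.
have {}alt_g u : bform u (g *m u) = 0.
  by apply/eqP; apply: contra_notT alt_g => ?; exists u.
have gJ : g^T *m J = J *m g.
  apply/eqP; rewrite -eqr_opp -mulmxN -J_tr -trmx_mul; apply/eqP.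
  apply: alternating_tr => u; rewrite -mulmxA -mulmxA mulmxA mulmx_bform alt_g.
  by rewrite raddf0.
have g2 : g *m g = 1%:M.
  by rewrite -[RHS](mulVmx J_nondeg) -{2}Jg gJ !mulmxA mulVmx // mul1mx.
have [x gx] : exists x, (g - 1%:M) *m x != 0.
  have : g - 1%:M != 0 by rewrite subr_eq0.
  case/matrix0Pn => i [j gij]; exists (delta_mx j 0); rewrite -colE.
  by apply/matrix0Pn; exists i, 0; rewrite mxE.
pose w := (g - 1%:M) *m x.
have gw : g *m w = - w.
  by rewrite /w !mulmxA mulmxBr g2 mulmx1 -mulNmx opprB.
have [u wu] := bform_nondeg gx; rewrite -/w in wu.
have Jtg : in_Sp J (transvection w 1 *m g) by apply/SpM/Jg/transvection_Sp.
have wgu : bform w (g *m u) = - bform w u.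
  rewrite -(bform_Sp _ _ Jg) gw mulmxA g2 mul1mx.
  by rewrite -[- w]sub0r bformBl -{1}[0](subrr w) bformBl subrr sub0r.
have /(transvection_rank_lt Jtg)[v [a lt_va]] : bform u (transvection w 1 *m g *m u)
  != 0.
  rewrite -mulmxA transvection_apply bformDr alt_g add0r bformZr mul1r.
  by rewrite wgu (bformC u w) mulrNN mulf_neq0.
exists v, a, w, 1; apply: leq_trans lt_va _; apply: mxrankS.
apply/submxP; exists (1%:M - w *m x^T *m J).
have wJg : w^T *m J *m g = - (x^T *m J *m (g - 1%:M)).
  rewrite /w trmx_mul linearB /= trmx1 mulmxBr mulmx1 !mulmxBl -!mulmxA.
  by rewrite (mulmxA g^T) Jg mulmxBr mulmx1 mulmxBr opprB.
rewrite /transvection mulmxDl mul1mx addrAC scale1r -(mulmxA w) wJg.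
by rewrite mulmxN [RHS]mulmxBl mul1mx !mulmxA.
Qed.

Definition transvections (vs : seq ('cV[K]_n * K)) : 'M[K]_n :=
  foldr (fun va h => transvection va.1 va.2 *m h) 1%:M vs.

Lemma Sp_transvections g : in_Sp J g -> exists vs, g = transvections vs.
Proof.
elim/ltn_ind: {g}(\rank _) {-2}g (erefl (\rank (g - 1%:M))) => r IHr g def_r Jg.
have [->|g_neq1] := eqVneq g 1%:M; first by exists [::].
have [v [a [w [b lt_r]]]] := transvection_rank_lt_neq1 Jg g_neq1.
rewrite def_r in lt_r; have [|vs def_g] := IHr _ lt_r _ (erefl _).
  by do 2?[apply: SpM; first exact: transvection_Sp].
exists ((w, - b) :: (v, - a) :: vs); rewrite /= -def_g.
rewrite (mulmxA (transvection v (- a))) (mulmx1C (transvectionN v a)) mul1mx.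
by rewrite mulmxA (mulmx1C (transvectionN w b)) mul1mx.
Qed.

End Transvections.

(** * Density of the big cell *)

Section UDL.

(** The product of the lower right corner minors of all sizes. As a single ring element it becomes
    one polynomial along a curve of matrices. *)
Fixpoint trailing_minors (R : comPzRingType) (n : nat) : 'M[R]_n -> R :=
  match n with
  | 0 => fun=> 1
  | m.+1 => fun A => \det A * trailing_minors (drsubmx (A : 'M_(1 + m)))
  end.

Lemma trailing_minors_map (R S : comPzRingType) (f : {rmorphism R -> S}) n
    (A : 'M[R]_n) : trailing_minors (map_mx f A) = f (trailing_minors A).
Proof.
elim: n A => [|n IHn] A /=; first by rewrite rmorph1.
by rewrite det_map_mx -map_drsubmx IHn rmorphM.
Qed.

Lemma trailing_minors1 (R : comPzRingType) n : trailing_minors (1%:M : 'M[R]_n) = 1.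
Proof.
elim: n => //= n IHn; rewrite det1 mul1r.
by rewrite (scalar_mx_block 1 n) block_mxKdr.
Qed.

Variable K : fieldType.

Definition upper_unipotent n (U : 'M[K]_n) :=
  forall i j : 'I_n, (j <= i)%N -> U i j = (i == j)%:R.

Lemma upper_unipotent_block n (X : 'M[K]_(1, n)) (U : 'M[K]_n) :
  upper_unipotent U -> @upper_unipotent (1 + n) (block_mx 1%:M X 0 U).
Proof.
move=> uniU i j.
case: (split_ordP i) => {}i ->; case: (split_ordP j) => {}j ->.
- by rewrite block_mxEul mxE !ord1.
- by rewrite (ord1 i) /=; lia.
- by rewrite block_mxEdl mxE (_ : (_ == _) = false) //;
  apply/eqP => /(congr1 val) /=; have := ltn_ord j; lia.
- rewrite block_mxEdr /= leq_add2l => /uniU ->.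
  by rewrite (inj_eq (@rshift_inj 1 n)).
Qed.

Lemma trailing_minors_unit n (A : 'M[K]_n) : trailing_minors A != 0 -> A \in unitmx.
Proof.
rewrite unitmxE unitfE; case: n A => [|n] A; first by rewrite det_mx00 oner_eq0.
by rewrite /= mulf_eq0 negb_or => /andP[].
Qed.

Lemma trailing_minors_UDL n (A : 'M[K]_n) : trailing_minors A != 0 ->
  exists U D L : 'M[K]_n, [/\ upper_unipotent U, is_diag_mx D,
    upper_unipotent L^T & A = U *m D *m L].
Proof.
elim: n A => [|n IHn] A.
  exists 1%:M, 1%:M, 1%:M; split; first by case.
  - exact: scalar_mx_is_diag.
  - by case.
  - by rewrite [LHS]flatmx0 [RHS]flatmx0.
rewrite [trailing_minors A]/=; set d := drsubmx _.
rewrite mulf_eq0 negb_or => /andP[_ d_minors].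
have d_unit := trailing_minors_unit d_minors.
have [U [D [L [uniU diagD uniL def_d]]]] := IHn _ d_minors.
pose b := ursubmx (A : 'M_(1 + n)); pose c := dlsubmx (A : 'M_(1 + n)).
(* [a] is the Schur complement of the block [d]. *)
pose a := ulsubmx (A : 'M_(1 + n)) - b *m invmx d *m c.
pose U1 : 'M_(1 + n) := block_mx 1%:M (b *m invmx d *m U) 0 U.
pose D1 : 'M_(1 + n) := block_mx a 0 0 D.
pose L1 : 'M_(1 + n) := block_mx 1%:M 0 (L *m invmx d *m c) L.
exists U1, D1, L1; split.
- exact: upper_unipotent_block.
- have diag_a : is_diag_mx a by apply/is_diag_mxP => i j; rewrite !ord1.
  by have := @is_diag_block_mx K 1 n 1 n a 0 0 D erefl; rewrite !eqxx diag_a diagD.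
- by rewrite (tr_block_mx (1%:M : 'M_1)) trmx1 trmx0; apply: upper_unipotent_block.
suff: (A : 'M_(1 + n)) = U1 *m D1 *m L1 by [].
rewrite !mulmx_block !mul1mx !mulmx0 !mul0mx !mulmx1 !addr0 !add0r.
have UDLd : U *m D *m L *m invmx d = 1%:M by rewrite -def_d mulmxV.
have -> : b *m invmx d *m U *m D *m (L *m invmx d *m c) = b *m invmx d *m c.
  rewrite -!mulmxA; congr (_ *m (_ *m _)).
  by rewrite -[RHS]mul1mx -UDLd -!mulmxA.
have -> : b *m invmx d *m U *m D *m L = b.
  by rewrite -!mulmxA (mulmxA U) -def_d mulVmx // mulmx1.
rewrite !mulmxA UDLd mul1mx -def_d subrK.
exact/esym/(@submxK _ 1 n 1 n A).
Qed.

(** [Y] is recovered row by row: once the rows above i are those of the identity, entry (i, l) of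
    the product is [X i i * Y i l], plus [X i l] if l < i. *)
Lemma is_trig_upper_unipotent_inv n (X Y : 'M[K]_n) :
  is_trig_mx X -> upper_unipotent Y -> X *m Y = 1%:M -> Y = 1%:M.
Proof.
move=> /is_trig_mxP trigX uniY XY.
suff Y1 m (i j : 'I_n) : (i < m)%N -> Y i j = (i == j)%:R.
  by apply/matrixP => i j; rewrite (Y1 n) ?mxE.
elim: m => // m IHm in i j *; rewrite ltnS leq_eqVlt => /predU1P[def_m|];
  last exact: IHm.
have XYi l : \sum_(k < n) X i k * Y k l =
    X i i * Y i l + (if (l < i)%N then X i l else 0).
  rewrite (bigD1 i) //=; congr (_ + _).
  case: (ltnP l i) => [lt_li|ge_li].
    rewrite (bigD1 l) /=; last by apply: contraTneq lt_li => ->; rewrite ltnn.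
    rewrite uniY // eqxx mulr1 big1 ?addr0 // => k /andP[neq_ki neq_kl].
    case: (ltngtP k i) => [lt_ki|lt_ik|/val_inj eq_ki].
    - by rewrite IHm -?def_m // (negPf neq_kl) mulr0.
    - by rewrite trigX // mul0r.
    - by rewrite eq_ki eqxx in neq_ki.
  rewrite big1 // => k neq_ki.
  case: (ltngtP k i) => [lt_ki|lt_ik|/val_inj eq_ki].
  - rewrite IHm -?def_m // (_ : (k == l) = false) ?mulr0 //.
    by apply: contraTF lt_ki => /eqP ->; rewrite -leqNgt.
  - by rewrite trigX // mul0r.
  - by rewrite eq_ki eqxx in neq_ki.
have [le_ji|lt_ij] := leqP j i; first exact: uniY.
have Xii : X i i = 1.
  move/matrixP/(_ i i): XY; rewrite !mxE XYi ltnn addr0 eqxx.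
  by rewrite uniY // eqxx mulr1.
move/matrixP/(_ i j): XY; rewrite !mxE XYi.
by rewrite ltnNge (ltnW lt_ij) Xii mul1r addr0.
Qed.

End UDL.

Section BigCell.
Variables (K : closedFieldType) (n : nat) (J : 'M[K]_n).
Hypotheses (J_alt : alternating_mx J) (J_nondeg : nondegenerate_mx J).
Variable B : 'M[K]_n.
Hypothesis B_basis : symplectic_basis J B.

Local Notation J0 := (B^T *m J *m B).

Lemma std_form i j : J0 i j =
  if (i + j == n.-1)%N then (if (i < j)%N then 1 else -1) else 0.
Proof. by rewrite B_basis mxE. Qed.

Lemma std_form_orth : J0^T *m J0 = 1%:M.
Proof.
apply/matrixP => i j; rewrite mxE.
under eq_bigr do rewrite mxE !std_form.
rewrite (bigD1 (rev_ord i)) //= big1 => [|k neq_k].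
  have -> : (n - i.+1 + i == n.-1)%N by have := ltn_ord i; lia.
  have -> : (n - i.+1 + j == n.-1)%N = (i == j).
    by rewrite -(inj_eq val_inj) /=; have := ltn_ord i; have := ltn_ord j; lia.
  rewrite mxE addr0; case: eqP => [<-|_]; last by rewrite mulr0.
  by case: ifP; rewrite ?mulrNN mulr1.
case: eqP => [eq_ki|_]; last by rewrite mul0r.
case/eqP: neq_k; apply: val_inj => /=; lia.
Qed.

Lemma std_form_orthC : J0 *m J0^T = 1%:M.
Proof. exact/mulmx1C/std_form_orth. Qed.

Lemma basis_unit : B \in unitmx.
Proof.
have /mulmx1_unit[_] := std_form_orth.
by rewrite unitmx_mul => /andP[].
Qed.

(** The adjoint for the form written in the basis B: [J0] is a signed permutation matrix, so [J0^T]
    is its inverse. *)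
Definition std_adj (M : 'M[K]_n) := J0^T *m M^T *m J0.

Lemma std_adjM M N : std_adj (M *m N) = std_adj N *m std_adj M.
Proof.
rewrite /std_adj; move: J0 std_form_orthC => j jj.
by rewrite trmx_mul -!mulmxA (mulmxA j j^T) jj mul1mx.
Qed.

(** Up to signs, [std_adj] is reflection in the antidiagonal, which keeps upper triangular, lower
    triangular and diagonal matrices in their class. The signs cancel on the diagonal. *)
Lemma std_adjE i j : exists2 c : K, c * c = 1 &
  forall M, std_adj M i j = (if i == j then 1 else c) * M (rev_ord j) (rev_ord i).
Proof.
pose sg (k : 'I_n) : K := if (n - k.+1 < k)%N then 1 else -1.
have sg2 k : sg k * sg k = 1 by rewrite /sg; case: ifP; rewrite ?mulrNN mulr1.
exists (sg i * sg j); first by rewrite mulrACA !sg2 mulr1.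
move=> M; rewrite /std_adj.
have -> : J0^T *m M^T = \matrix_(k, l) (sg k * M l (rev_ord k)).
  apply/matrixP => k l; rewrite [RHS]mxE mxE (bigD1 (rev_ord k)) //= big1 => [|m neq_m].
    rewrite mxE std_form mxE /= addr0.
    by have -> : (n - k.+1 + k == n.-1)%N by have := ltn_ord k; lia.
  rewrite mxE std_form (_ : (_ == _) = false) ?mul0r //; apply: contraNF neq_m => eq_mk.
  by apply/eqP/val_inj => /=; have := ltn_ord k; lia.
rewrite mxE (bigD1 (rev_ord j)) //= big1 => [|k neq_k]; last first.
  rewrite std_form (_ : (_ == _) = false) ?mulr0 //; apply: contraNF neq_k => eq_kj.
  by apply/eqP/val_inj => /=; have := ltn_ord j; lia.
rewrite std_form mxE addr0 /=.
have -> : (n - j.+1 + j == n.-1)%N by have := ltn_ord j; lia.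
by rewrite mulrAC -/(sg j); case: eqP => [->|_] //; rewrite sg2.
Qed.
Lemma std_adj_tr M : std_adj M^T = (std_adj M)^T.
Proof. by rewrite /std_adj !trmx_mul !trmxK !mulmxA. Qed.

Lemma std_adj_upper U : upper_unipotent U -> upper_unipotent (std_adj U).
Proof.
move=> uniU i j le_ji; have [c _ ->] := std_adjE i j.
rewrite uniU /=; last by have := ltn_ord i; lia.
rewrite (inj_eq rev_ord_inj) eq_sym.
by case: eqP => _; rewrite ?mulr1 ?mulr0.
Qed.

Lemma std_adj_diag D : is_diag_mx D -> is_diag_mx (std_adj D).
Proof.
move=> /is_diag_mxP diagD; apply/is_diag_mxP => i j neq_ij.
have [c _ ->] := std_adjE i j; rewrite diagD ?mulr0 //.
by have := ltn_ord i; have := ltn_ord j => /=; lia.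
Qed.

Lemma upper_unipotentM U V :
  upper_unipotent U -> upper_unipotent V -> upper_unipotent (U *m V : 'M[K]_n).
Proof.
move=> uniU uniV i j le_ji; rewrite mxE (bigD1 i) //= big1 => [|k neq_ki].
  by rewrite addr0 uniU // eqxx mul1r uniV.
have [le_ki|lt_ik] := leqP k i.
  by rewrite uniU // eq_sym (negPf neq_ki) mul0r.
rewrite uniV; last by apply: leq_trans (ltnW lt_ik).
by rewrite (_ : (k == j) = false) ?mulr0 //; apply: contraTF lt_ik => /eqP ->;
  rewrite -leqNgt.
Qed.

(* By uniqueness of the factorization: [std_adj] inverts symplectic matrices and
   preserves each of the three shapes. *)
Lemma std_adj_UDL (U D L : 'M[K]_n) :
  upper_unipotent U -> is_diag_mx D -> upper_unipotent L^T ->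
  std_adj (U *m D *m L) *m (U *m D *m L) = 1%:M ->
  [/\ std_adj U *m U = 1%:M, std_adj D *m D = 1%:M & std_adj L *m L = 1%:M].
Proof.
move=> uniU diagD uniL /mulmx1C; rewrite !std_adjM => UDL1.
pose Z := L *m std_adj L; pose X := D *m Z *m std_adj D; pose Y := std_adj U *m U.
have XY : X *m Y = 1%:M.
  by rewrite /Y mulmxA; apply: mulmx1C; rewrite -[RHS]UDL1 /X /Z !mulmxA.
have uniZ : upper_unipotent Z^T.
  by rewrite /Z trmx_mul -std_adj_tr; apply/upper_unipotentM => //;
    exact: std_adj_upper.
have XE i j : X i j = D i i * Z i j * std_adj D j j.
  have [/is_diag_mxP diagD' /is_diag_mxP diagDd] := (std_adj_diag diagD, diagD).
  rewrite /X mxE (bigD1 j) //= big1 => [|k neq_kj]; last by rewrite diagD' ?mulr0.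
  rewrite mxE (bigD1 i) //= big1 => [|k neq_ki]; last first.
    by rewrite diagDd ?mul0r // eq_sym.
  by rewrite !addr0.
have Y1 : Y = 1%:M.
  apply: is_trig_upper_unipotent_inv XY; last by apply: upper_unipotentM => //;
    exact: std_adj_upper.
  apply/is_trig_mxP => i j lt_ij; rewrite XE.
  have := uniZ j i (ltnW lt_ij); rewrite mxE => ->.
  by rewrite (_ : (j == i) = false) ?mulr0 ?mul0r //;
    apply: contraTF lt_ij => /eqP ->; rewrite ltnn.
have X1 : X = 1%:M by rewrite -XY Y1 mulmx1.
have Z1 : Z = 1%:M.
  have X1E i j : D i i * Z i j * std_adj D j j = (i == j)%:R by rewrite -XE X1 mxE.
  have Zii i : Z i i = 1 by have := uniZ i i (leqnn i); rewrite mxE eqxx.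
  have DDneq0 i : D i i * std_adj D i i != 0.
    by have := X1E i i; rewrite Zii mulr1 eqxx => ->; exact: oner_neq0.
  apply/matrixP => i j; rewrite [RHS]mxE; case: (eqVneq i j) => [->|neq_ij];
    first by rewrite Zii.
  have := X1E i j; rewrite (negPf neq_ij) => /eqP.
  have := DDneq0 i; have := DDneq0 j; rewrite !mulf_eq0 !negb_or.
  by move=> /andP[_ /negPf ->] /andP[/negPf -> _]; rewrite orbF /= => /eqP.
split=> //; apply: mulmx1C => //.
by rewrite -[RHS]X1 /X Z1 mulmx1.
Qed.

Lemma std_adj_Sp M : std_adj M *m M = 1%:M -> in_Sp J (B *m M *m invmx B).
Proof.
move=> adjM; have MJ0M : M^T *m J0 *m M = J0.
  move: adjM; rewrite /std_adj; move: J0 std_form_orthC => j jj adjM.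
  by rewrite -[RHS]mulmx1 -adjM !mulmxA jj mul1mx.
have -> : in_Sp J (B *m M *m invmx B) =
    ((invmx B)^T *m (M^T *m J0 *m M) *m invmx B = J).
  by rewrite /in_Sp !trmx_mul !mulmxA.
rewrite MJ0M !mulmxA -trmx_mul mulmxV ?basis_unit // trmx1 mul1mx.
by rewrite mulmxK ?basis_unit.
Qed.

Lemma Sp_std_adj g : in_Sp J g ->
  std_adj (invmx B *m g *m B) *m (invmx B *m g *m B) = 1%:M.
Proof.
have Bu := basis_unit => Jg; pose h := invmx B *m g *m B.
have J0E (M : 'M[K]_n) : M^T *m J0 *m M = (B *m M)^T *m J *m (B *m M).
  by rewrite trmx_mul !mulmxA.
have hJ0h : h^T *m J0 *m h = J0.
  rewrite J0E {J0E} /h !mulmxA mulmxV // mul1mx trmx_mul.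
  by rewrite mulmxK // -(mulmxA B^T g^T) -(mulmxA B^T _ g) Jg.
rewrite -/h /std_adj; clearbody h; move: J0 std_form_orth hJ0h => j jj hjh.
by rewrite -!mulmxA (mulmxA h^T) hjh.
Qed.

Lemma Sp_conj1 g : in_Sp J g ->
  (invmx B *m g *m B) *m (invmx B *m form_adj J g *m B) = 1%:M.
Proof.
have Bu := basis_unit => /(mulmx_form_adj J_nondeg); move: (form_adj J g) => g' gg'.
by rewrite !mulmxA mulmxK // -(mulmxA _ g) gg' mulmx1 mulVmx.
Qed.

(** The condition is put on the inverse of g: trailing minors give the order upper, diagonal, lower,
    and inverting reverses it to lower, torus, upper. *)
Lemma big_cell g : in_Sp J g ->
  trailing_minors (invmx B *m form_adj J g *m B) != 0 ->
  exists u t w, [/\ in_Sp J u /\ upper_unipotent (invmx B *m u *m B)^T,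
    in_torus J B t, in_unipotent J B w & g = u *m t *m w].
Proof.
have Bu := basis_unit => Jg /trailing_minors_UDL[U [D [L [uniU diagD uniL defk]]]].
have := Sp_std_adj (SpV J_nondeg Jg).
set k := invmx B *m form_adj J g *m B => kk.
have def_h : invmx B *m g *m B = std_adj k.
  have kh : k *m (invmx B *m g *m B) = 1%:M := mulmx1C (Sp_conj1 Jg).
  by rewrite -[LHS]mul1mx -kk -(mulmxA (std_adj k) k) kh mulmx1.
rewrite /k defk in kk def_h.
have [UU DD LL] := std_adj_UDL uniU diagD uniL kk.
have adjV M : std_adj M *m M = 1%:M -> std_adj (std_adj M) *m std_adj M = 1%:M.
  move=> MM; rewrite -std_adjM (mulmx1C MM) /std_adj trmx1 mulmx1.
  exact: std_form_orth.
have conjK M : invmx B *m (B *m M *m invmx B) *m B = M.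
  by rewrite !mulmxA mulVmx // mul1mx mulmxKV.
exists (B *m std_adj L *m invmx B), (B *m std_adj D *m invmx B).
exists (B *m std_adj U *m invmx B); split.
- by split; [exact/std_adj_Sp/adjV | rewrite conjK -std_adj_tr; exact: std_adj_upper].
- by split; [exact/std_adj_Sp/adjV | rewrite conjK; exact: std_adj_diag].
- by split; [exact/std_adj_Sp/adjV | rewrite conjK; exact: std_adj_upper].
have -> : g = B *m std_adj (U *m D *m L) *m invmx B.
  by rewrite -def_h !mulmxA mulmxV // mul1mx mulmxK.
by rewrite !std_adjM !mulmxA !mulmxKV.
Qed.

(** Write the inverse of g as a product of transvections, scale all their parameters by s and
    multiply by g on the left. *)
Lemma Sp_curve g : in_Sp J g -> exists G : 'M[{poly K}]_n,
  [/\ forall s, in_Sp J (map_mx (horner_eval s) G),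
      map_mx (horner_eval 0) G = g & map_mx (horner_eval 1) G = 1%:M].
Proof.
move=> Jg; have [vs def_vs] := Sp_transvections J_alt J_nondeg (SpV J_nondeg Jg).
pose tv (va : 'cV[K]_n * K) : 'M[{poly K}]_n :=
  1%:M + ('X * va.2%:P) *: map_mx polyC (va.1 *m (va.1^T *m J)).
pose G := map_mx polyC g *m foldr (fun va h => tv va *m h) 1%:M vs.
have evalC m (M : 'M[K]_(m, n)) s : map_mx (horner_eval s) (map_mx polyC M) = M.
  by apply/matrixP => i j; rewrite !mxE /horner_eval hornerC.
have evalG s : map_mx (horner_eval s) G
    = g *m transvections J [seq (va.1, s * va.2) | va <- vs].
  rewrite /G map_mxM evalC; congr (_ *m _).
  elim: vs {def_vs G} => [|va vs IHvs] /=; first by rewrite map_mx1.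
  rewrite map_mxM IHvs; congr (_ *m _).
  rewrite /tv map_mxD map_mx1 map_mxZ evalC /transvection.
  by rewrite /= horner_evalE hornerM hornerX hornerC.
exists G; split=> [s||]; rewrite evalG.
- apply: SpM => //; elim: vs {def_vs G evalG} => [|va vs IHvs] /=; first exact: Sp1.
  by apply: SpM => //; apply: transvection_Sp.
- rewrite -[RHS]mulmx1; congr (_ *m _).
  elim: vs {def_vs G evalG} => //= va vs ->.
  by rewrite mul0r /transvection scale0r addr0 mulmx1.
- rewrite -(mulmx_form_adj J_nondeg Jg) def_vs; congr (_ *m transvections _ _).
  by rewrite -[RHS]map_id; apply: eq_map => -[v a]; rewrite mul1r.
Qed.

(** On a curve from g to 1, the product of minors that detects the big cell is a polynomial r(s)
    with r(1) = 1. The restriction of P to the curve vanishes wherever r does not, hence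
    identically, in particular at s = 0. *)
Lemma big_cell_dense (P : {mpoly K[n * n]}) :
  (forall u t w, in_Sp J u -> upper_unipotent (invmx B *m u *m B)^T ->
     in_torus J B t -> in_unipotent J B w -> mxeval P (u *m t *m w) = 0) ->
  forall g, in_Sp J g -> mxeval P g = 0.
Proof.
move=> P0 g Jg; have [G [JG G0 G1]] := Sp_curve Jg.
pose q := mpoly_curve P G; have qE := mpoly_curveE P G; rewrite -/q in qE.
pose C := map_mx (@polyC K) : 'M[K]_n -> 'M[{poly K}]_n.
pose r := trailing_minors (C (invmx B *m invmx J) *m G^T *m C (J *m B)).
have evalC (M : 'M[K]_n) s : map_mx (horner_eval s) (C M) = M.
  by apply/matrixP => i j; rewrite !mxE /horner_eval hornerC.
have rE s : r.[s] = trailing_minors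
    (invmx B *m form_adj J (map_mx (horner_eval s) G) *m B).
  rewrite -[r.[s]]/(horner_eval s r) -trailing_minors_map !map_mxM !evalC.
  by rewrite -map_trmx /form_adj !mulmxA.
have r_neq0 : r != 0.
  apply: contra_neq (oner_neq0 K) => r0.
  have := rE 1; rewrite r0 horner0 G1 => ->.
  have -> : form_adj J 1%:M = 1%:M by rewrite /form_adj trmx1 mulmx1 mulVmx.
  by rewrite mulmx1 mulVmx ?basis_unit // trailing_minors1.
have q0 : q = 0.
  apply: (poly_closed_eq0 r_neq0) => s; rewrite rE qE => /(big_cell (JG s)).
  by move=> [u [t [w [[Ju uniu] tt uniw ->]]]]; exact: P0.
by rewrite -G0 -qE q0 horner0.
Qed.

End BigCell.

(** * Subspaces spanned by a predicate *)

Section Spans.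
Variables (K : fieldType) (vT : vectType K).

(** The span of a possibly infinite set, characterised by its induction principle. A finite list of
    elements of P is extended until it spans; [k] bounds the dimension still missing. *)
Lemma span_pred (P : vT -> Prop) : exists U : {vspace vT},
  (forall x, P x -> x \in U) /\
  forall Q : vT -> Prop, Q 0 -> (forall c x y, Q x -> Q y -> Q (c *: x + y)) ->
    (forall x, P x -> Q x) -> forall x, x \in U -> Q x.
Proof.
suff [X [PX XP]] : exists X : seq vT,
    (forall x, x \in X -> P x) /\ forall x, P x -> x \in <<X>>%VS.
  exists <<X>>%VS; split=> // Q Q0 Qlin PQ x /(coord_span (X := in_tuple X)) ->.
  apply: (big_ind Q) => // [y z Qy Qz|i _].
    by rewrite -[y]scale1r; exact: Qlin.
  rewrite -[_ *: _]addr0; apply: Qlin => //.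
  by apply/PQ/PX/mem_nth.
suff extend k (X : seq vT) : (forall x, x \in X -> P x) ->
    (\dim {:vT} <= \dim <<X>> + k)%N -> exists X : seq vT,
    (forall x, x \in X -> P x) /\ forall x, P x -> x \in <<X>>%VS.
  by apply: (extend (\dim {:vT}) [::]) => //; rewrite leq_addl.
elim: k X => [|k IHk] X PX dimX.
  exists X; split=> // x _; have /eqP -> : <<X>>%VS == fullv; last exact: memvf.
  by rewrite eqEdim subvf -[\dim <<X>>]addn0.
have [[x [Px notXx]]|XP] := classic (exists x, P x /\ x \notin <<X>>%VS); last first.
  by exists X; split=> // x Px; apply: contra_notT XP => notXx; exists x.
apply: (IHk (x :: X)) => [y|].
  by rewrite inE => /predU1P[->|/PX].
apply: leq_trans dimX _; rewrite addnS -addSn leq_add2r span_cons addvC.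
rewrite ltn_neqAle dimvS ?addvSl // andbT; apply: contra notXx => eq_dim.
have /eqP -> : <<X>>%VS == (<<X>> + <[x]>)%VS by rewrite -(geq_leqif (dimv_leqif_eq
  (addvSl _ _))) (eqP eq_dim).
by rewrite (subvP (addvSr _ _)) ?memv_line.
Qed.

Lemma separating_functional (U : {vspace vT}) x : x \notin U ->
  exists f : vT -> K, [/\ forall c y z, f (c *: y + z) = c * f y + f z,
    forall y, y \in U -> f y = 0 & f x != 0].
Proof.
move=> notUx; pose r y := y - projv U y.
have rx : r x != 0.
  by rewrite subr_eq0; apply: contraNneq notUx => ->; exact: memv_proj.
have [i rxi] : exists i, coord (vbasis {:vT}) i (r x) != 0.
  apply/existsP; apply: contraT; rewrite negb_exists => /forallP r0.
  case/eqP: rx; rewrite (coord_vbasis (memvf (r x))) big1 // => i _.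
  by move: (r0 i); rewrite negbK => /eqP ->; rewrite scale0r.
exists (fun y => coord (vbasis {:vT}) i (r y)); split=> // [c y z|y Uy].
  have -> : r (c *: y + z) = c *: r y + r z.
    by rewrite /r linearP scalerBr opprD addrACA.
  by rewrite linearP.
by rewrite /r projv_id // subrr linear0.
Qed.

Lemma functional_sum (f : vT -> K) (I : Type) (r : seq I) (c : I -> K) (v : I -> vT) :
  (forall c y z, f (c *: y + z) = c * f y + f z) ->
  f (\sum_(i <- r) c i *: v i) = \sum_(i <- r) c i * f (v i).
Proof.
move=> flin; have f0 : f 0 = 0.
  by have := flin (-1) 0 0; rewrite scaler0 addr0 mulN1r addNr.
by elim: r => [|i r IHr]; rewrite ?big_nil ?big_cons // flin IHr.
Qed.

End Spans.

(** * Isotropic pairs of vectors *)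

Section Isotropic.
Variables (K : fieldType) (n : nat) (J : 'M[K]_n).
Hypotheses (J_alt : alternating_mx J) (J_nondeg : nondegenerate_mx J).
Implicit Types (u v w x y : 'cV[K]_n) (g h Z : 'M[K]_n).
Local Notation bf := (bform J).

Lemma bform_perp_line u v :
  (forall w, bf u w = 0 -> bf v w = 0) -> exists c, v = c *: u.
Proof.
have bf_col x (C : 'M[K]_n) j : bf x (col j C) = (x^T *m J *m C) 0 j.
  by rewrite /bform !colE mulmxA -colE mxE.
move=> uv; have : (v^T *m J <= u^T *m J)%MS.
  rewrite submxE; apply/eqP/rowP => j; rewrite -bf_col uv ?mxE //.
  by rewrite bf_col mulmx_coker mxE.
case/sub_rVP => c; rewrite scalemxAl => vJ; exists c; apply: trmx_inj.
by rewrite linearZ /= -[LHS](mulmxK J_nondeg) vJ mulmxK.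
Qed.

(** A transvection along y - x. Its fixed vectors are recorded so that one vector can be moved while
    another is held in place. *)
Lemma move_vector x y : bf x y != 0 ->
  exists g, [/\ in_Sp J g, g *m x = y & forall z, bf (y - x) z = 0 -> g *m z = z].
Proof.
move=> xy; exists (transvection J (y - x) (bf y x)^-1); split.
- exact: transvection_Sp.
- rewrite transvection_apply bformBl // (bform_alt J_alt x) subr0 mulVf.
    by rewrite scale1r addrC subrK.
  by rewrite bformC // oppr_eq0.
- by move=> z yxz; rewrite transvection_apply yxz mulr0 scale0r addr0.
Qed.

(** The candidates for w are listed because w then inherits every orthogonality relation common to a
    and b. *)
Lemma common_nonorth x y a b : bf x a != 0 -> bf y b != 0 ->
  exists2 w, w \in [:: a; b; a + b] & bf x w != 0 /\ bf y w != 0.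
Proof.
move=> xa yb; case: (eqVneq (bf y a) 0) => [ya|ya]; last first.
  by exists a; rewrite ?inE ?eqxx.
case: (eqVneq (bf x b) 0) => [xb|xb]; last first.
  by exists b; rewrite ?inE ?eqxx ?orbT.
by exists (a + b); rewrite ?inE ?eqxx ?orbT // !bformDr xb ya addr0 add0r.
Qed.

Lemma Sp_transitive x u : x != 0 -> u != 0 -> exists2 g, in_Sp J g & g *m x = u.
Proof.
move=> /(bform_nondeg J_nondeg)[a xa] /(bform_nondeg J_nondeg)[b ub].
have [w _ [xw uw]] := common_nonorth xa ub.
have [g1 [Jg1 g1x _]] := move_vector xw.
have [|g2 [Jg2 g2w _]] := @move_vector w u; first by rewrite bformC // oppr_eq0.
by exists (g2 *m g1); [exact: SpM | rewrite -mulmxA g1x].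
Qed.

Definition isotropic_pair u v := [/\ u != 0, forall c, v <> c *: u & bf u v = 0].

(** Once x has been moved to u, the image of y is moved to v through some w that is orthogonal to u
    but to neither end. Both transvections are along vectors orthogonal to u, so they fix u. *)
Lemma Sp_transitive_pair x y u v : isotropic_pair x y -> isotropic_pair u v ->
  exists g, [/\ in_Sp J g, g *m x = u & g *m y = v].
Proof.
move=> [x_neq0 yNx xy] [u_neq0 vNu uv].
have [g1 Jg1 g1x] := Sp_transitive x_neq0 u_neq0; pose y' := g1 *m y.
have uy' : bf u y' = 0 by rewrite -g1x bform_Sp.
have perp z : (forall c, z <> c *: u) -> exists a, bf u a = 0 /\ bf z a != 0.
  move=> zNu; apply: NNPP => noa; case: (@bform_perp_line u z) => [w uw|c];
    last exact: zNu.
  by apply/eqP; apply: contra_notT noa => zw; exists w.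
have [|a [ua y'a]] := perp y'.
  move=> c y'u; apply: (yNx c).
  by rewrite -[y]mul1mx -(form_adj_mulmx J_nondeg Jg1) -mulmxA -/y' y'u -g1x
    -scalemxAr mulmxA
             form_adj_mulmx // mul1mx.
have [b [ub vb]] := perp v vNu.
have [w w_ab [y'w vw]] := common_nonorth y'a vb.
have uw : bf u w = 0.
  by move: w_ab; rewrite !inE => /or3P[] /eqP -> //; rewrite bformDr ua ub addr0.
have [g2 [Jg2 g2y' g2u]] := move_vector y'w.
have [|g3 [Jg3 g3w g3u]] := @move_vector w v; first by rewrite bformC // oppr_eq0.
exists (g3 *m (g2 *m g1)); split; first by do 2?apply: SpM.
  have perpB z1 z2 : bf u z1 = 0 -> bf u z2 = 0 -> bf (z1 - z2) u = 0.
    by move=> uz1 uz2; rewrite bformC // bformBr uz1 uz2 subrr oppr0.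
  by rewrite -!mulmxA g1x g2u ?g3u // perpB.
by rewrite -!mulmxA -/y' g2y' g3w.
Qed.

Lemma eigen_all_scalar Z : (forall u, exists c, Z *m u = c *: u) -> exists c, Z = c%:M.
Proof.
move=> eigZ; case: n Z eigZ => [|m] Z eigZ; first by exists 0;
  rewrite [LHS]flatmx0 [RHS]flatmx0.
have Zd i j : i != j -> Z i j = 0.
  move=> neq_ij; have [c] := eigZ (delta_mx j 0); rewrite -colE => /colP/(_ i).
  by rewrite !mxE (negPf neq_ij) mulr0.
exists (Z 0 0); apply/matrixP => i j; rewrite mxE.
case: (eqVneq i j) => [<-|neq_ij]; last by rewrite Zd.
case: (eqVneq i 0) => [->|i_neq0] //.
have [c] := eigZ (delta_mx i 0 + delta_mx 0 0); rewrite mulmxDr -!colE => /colP Zc.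
have := Zc i; have := Zc 0;
  rewrite !mxE !eqxx (eq_sym 0 i) (negPf i_neq0) (Zd i 0) // (Zd 0 i) 1?eq_sym //.
by rewrite !addr0 !add0r !mulr1 => -> ->.
Qed.

(** Z u is orthogonal to everything orthogonal to u, hence a multiple of u. For multiples of u
    itself this is (u, Z u) = 0, which follows from self-adjointness because 2 is invertible. *)
Lemma isotropic_scalar Z : (2%:R : K) != 0 ->
  (forall u v, bf u (Z *m v) = bf (Z *m u) v) ->
  (forall u v, isotropic_pair u v -> bf v (Z *m u) = 0) -> exists c, Z = c%:M.
Proof.
move=> two_neq0 adjZ isoZ; apply: eigen_all_scalar => u.
have [->|u_neq0] := eqVneq u 0; first by exists 0; rewrite mulmx0 scaler0.
apply: bform_perp_line => w uw; rewrite bformC //.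
suff -> : bf w (Z *m u) = 0 by rewrite oppr0.
have [[c ->]|wNu] := classic (exists c, w = c *: u); last first.
  by apply: isoZ; split=> // c def_w; apply: wNu; exists c.
have uZu : bf u (Z *m u) = 0.
  have : bf u (Z *m u) = - bf u (Z *m u) by rewrite {1}adjZ bformC.
  move/eqP; rewrite -addr_eq0 -mulr2n -mulr_natl mulf_eq0 (negPf two_neq0) /=.
  by move/eqP.
by rewrite bformC // bformZr -adjZ uZu mulr0 oppr0.
Qed.

End Isotropic.

(** * The highest weight vector of the irreducible module *)

Section HighestWeight.
Variables (K : closedFieldType) (n : nat) (J : 'M[K]_n).
Hypotheses (J_alt : alternating_mx J) (J_nondeg : nondegenerate_mx J).
Variable B : 'M[K]_n.
Hypothesis B_basis : symplectic_basis J B.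
Variables (N : nat) (F : 'M[{mpoly K[n * n]}]_N).
Hypothesis F_rat : rational_rep J F.

Let Bu : B \in unitmx := basis_unit B_basis.
Let evalC m l (M : 'M[K]_(m, l)) s : map_mx (horner_eval s) (map_mx polyC M) = M.
Proof. by apply/matrixP => i j; rewrite !mxE /horner_eval hornerC. Qed.

(** Exponents 2i - (n - 1) in the basis B: they change sign under i -> n - 1 - i, so the matrix is
    symplectic, and they increase with i, so conjugation multiplies entries below the diagonal by
    positive powers of s. *)
Definition cochar s : 'M[K]_n :=
  B *m diag_mx (\row_(i < n) (s ^+ (2 * i) / s ^+ n.-1)) *m invmx B.

Lemma cochar_torus s : s != 0 -> in_torus J B (cochar s).
Proof.
move=> s_neq0; pose D := diag_mx (\row_(i < n) (s ^+ (2 * i) / s ^+ n.-1)).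
split; last first.
  by rewrite /cochar -/D !mulmxA mulVmx // mul1mx mulmxKV // diag_mx_is_diag.
apply: std_adj_Sp => //; rewrite -/D -(std_form_orth B_basis) /std_adj.
rewrite -!(mulmxA (B^T *m J *m B)^T); congr (_ *m _); rewrite tr_diag_mx.
apply/matrixP => i j; rewrite mul_mx_diag mxE mul_diag_mx mxE std_form //.
case: eqP => [eq_ij|_]; last by rewrite mulr0 mul0r.
rewrite mulrAC [_ * (if _ then _ else _)]mulrC !mxE mulf_div -exprD -mulnDr eq_ij.
by rewrite mul2n -addnn exprD divff ?mulr1 // mulf_neq0 // expf_neq0.
Qed.

Lemma form_adj_unique g h : in_Sp J g -> g *m h = 1%:M -> form_adj J g = h.
Proof.
by move=> Jg gh; rewrite -[LHS]mulmx1 -gh mulmxA form_adj_mulmx // mul1mx.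
Qed.

(* Conjugation by the one-parameter subgroup [cochar] contracts the lower
   unipotent subgroup to the identity as the parameter tends to 0. *)
Lemma cochar_contract u : upper_unipotent (invmx B *m u *m B)^T ->
  exists H : 'M[{poly K}]_n, map_mx (horner_eval 0) H = 1%:M /\
    forall s, s != 0 ->
      map_mx (horner_eval s) H = cochar s *m u *m form_adj J (cochar s).
Proof.
set h := invmx B *m u *m B => uni_h.
have def_u : u = B *m h *m invmx B by rewrite /h !mulmxA mulmxV // mul1mx mulmxK.
clearbody h; rewrite {}def_u.
pose X : 'M[{poly K}]_n := \matrix_(i, j) ((h i j)%:P * 'X^(2 * (i - j))).
exists (map_mx polyC B *m X *m map_mx polyC (invmx B)); split=> [|s s_neq0].
  rewrite !map_mxM !evalC (_ : map_mx _ X = 1%:M) ?mulmx1 ?mulmxV //.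
  apply/matrixP => i j;
    rewrite [LHS]mxE [X i j]mxE [RHS]mxE /= horner_evalE hornerM hornerC hornerXn.
  case: (leqP i j) => [le_ij|lt_ji].
    have := uni_h j i le_ij; rewrite mxE => ->.
    by rewrite (eqP (_ : (i - j == 0)%N)) ?subn_eq0 // muln0 expr0 mulr1 eq_sym.
  rewrite expr0n (_ : (2 * (i - j) == 0)%N = false) ?mulr0; last by lia.
  by rewrite (_ : (i == j) = false) //; apply: contraTF lt_ji => /eqP ->; rewrite ltnn.
have [Jt _] := cochar_torus s_neq0.
pose D' : 'M[K]_n := diag_mx (\row_(i < n) (s ^+ n.-1 / s ^+ (2 * i))).
have -> : form_adj J (cochar s) = B *m D' *m invmx B.
  apply: form_adj_unique => //; rewrite /cochar !mulmxA mulmxKV // -(mulmxA B).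
  rewrite (_ : diag_mx _ *m D' = 1%:M) ?mulmx1 ?mulmxV //.
  apply/matrixP => i j; rewrite mul_diag_mx !mxE.
  case: (eqVneq i j) => [->|]; rewrite ?mulr0 //=.
  by rewrite mulr1n; field; rewrite !expf_neq0.
rewrite !map_mxM !evalC /cochar !mulmxA; congr (_ *m _).
rewrite !mulmxKV // -!(mulmxA B); congr (_ *m _); apply/matrixP => i j;
  rewrite mul_mx_diag mxE mul_diag_mx !mxE.
rewrite /= horner_evalE hornerM hornerC hornerXn.
case: (leqP j i) => [le_ji|lt_ij]; last first.
  have := uni_h j i (ltnW lt_ij); rewrite mxE => ->.
  by rewrite (_ : (j == i) = false) ?mulr0 ?mul0r //;
    apply: contraTF lt_ij => /eqP ->; rewrite ltnn.
have -> : s ^+ (2 * i) = s ^+ (2 * (i - j)) * s ^+ (2 * j).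
  by rewrite -exprD -mulnDr subnK.
by field; rewrite !expf_neq0.
Qed.

Lemma rep_apply_mul g h (x : 'cV[K]_N) : in_Sp J g -> in_Sp J h ->
  poly_map F (g *m h) *m x = poly_map F g *m (poly_map F h *m x).
Proof. by case: F_rat => _ FM Jg Jh; rewrite FM // mulmxA. Qed.

Lemma rep_apply1 (x : 'cV[K]_N) : poly_map F 1%:M *m x = x.
Proof. by case: F_rat => -> _; rewrite mul1mx. Qed.

Lemma torus_eigenvalue_neq0 t (w : 'cV[K]_N) c :
  in_Sp J t -> w != 0 -> poly_map F t *m w = c *: w -> c != 0.
Proof.
move=> Jt w_neq0 tw; apply: contra_neq w_neq0 => c0.
rewrite -[w]rep_apply1 -(form_adj_mulmx J_nondeg Jt) rep_apply_mul //; last exact: SpV.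
by rewrite tw c0 scale0r mulmx0.
Qed.

(** It suffices that w lies outside the span of the vectors u w - w. On that span [cochar s] acts as
    [chi (cochar s)] times a polynomial vector that vanishes at s = 0, because u is contracted to 1.
    For w itself that polynomial vector would be the constant w. *)
Lemma lowest_functional (w : 'cV[K]_N) (chi : 'M[K]_n -> K) : w != 0 ->
  (forall t, in_torus J B t -> poly_map F t *m w = chi t *: w) ->
  exists f : 'cV[K]_N -> K, [/\ forall c y z, f (c *: y + z) = c * f y + f z,
    f w != 0 & forall u, in_Sp J u -> upper_unipotent (invmx B *m u *m B)^T ->
      f (poly_map F u *m w) = f w].
Proof.
move=> w_neq0 tw.
have [U [PU UQ]] := span_pred (fun x : 'cV[K]_N => exists u,
  [/\ in_Sp J u, upper_unipotent (invmx B *m u *m B)^T & x = poly_map F u *m w - w]).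
suff notUw : w \notin U.
  have [f [flin fU fw]] := separating_functional notUw; exists f; split=> // u Ju uni_u.
  have -> : poly_map F u *m w = 1 *: (poly_map F u *m w - w) + w.
    by rewrite scale1r subrK.
  by rewrite flin fU ?mulr0 ?add0r //; apply: PU; exists u.
pose Q (x : 'cV[K]_N) := exists r : 'cV[{poly K}]_N, map_mx (horner_eval 0) r = 0 /\
  forall s, s != 0 ->
    poly_map F (cochar s) *m x = chi (cochar s) *: map_mx (horner_eval s) r.
apply/negP => /(UQ Q) Qw.
have {Qw} : Q w.
  apply: Qw => [|c x y [r [r0 rE]] [q [q0 qE]]|_ [u [Ju uni_u ->]]].
  - by exists 0; split=> [|s _]; rewrite map_mx0 ?scaler0 ?mulmx0.
  - have evalZD s : map_mx (horner_eval s) (c%:P *: r + q)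
        = c *: map_mx (horner_eval s) r + map_mx (horner_eval s) q.
      by apply/matrixP => i j; rewrite !mxE /horner_eval hornerD hornerM hornerC.
    exists (c%:P *: r + q); split=> [|s s_neq0]; rewrite evalZD.
      by rewrite r0 q0 scaler0 addr0.
    by rewrite mulmxDr -scalemxAr rE // qE // scalerDr !scalerA mulrC.
  have [H [H0 HE]] := cochar_contract uni_u.
  pose FH := \matrix_(i, j) mpoly_curve (F i j) H : 'M[{poly K}]_N.
  have FHE s : map_mx (horner_eval s) FH = poly_map F (map_mx (horner_eval s) H).
    apply/matrixP => i j; rewrite !mxE /horner_eval.
    exact: mpoly_curveE.
  exists (FH *m map_mx polyC w - map_mx polyC w); split=> [|s s_neq0].
    by rewrite map_mxB map_mxM !evalC FHE H0 rep_apply1 subrr.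
  have [Jt _] := cochar_torus s_neq0.
  rewrite map_mxB map_mxM !evalC FHE HE // mulmxBr scalerBr (tw _ (cochar_torus
    s_neq0)).
  congr (_ - _); rewrite scalemxAr -(tw _ (cochar_torus s_neq0)).
  have Jtu := SpM Jt Ju; have Jtut := SpM Jtu (SpV J_nondeg Jt).
  rewrite -!rep_apply_mul //.
  by rewrite -(mulmxA (cochar s *m u)) form_adj_mulmx // mulmx1.
have chi_neq0 s : s != 0 -> chi (cochar s) != 0.
  by move=> /cochar_torus tor; apply: torus_eigenvalue_neq0 (tw _ tor); case: tor.
case=> r [r0 rE]; case/eqP: w_neq0; apply/colP => i; rewrite mxE.
have q0 : r i 0 - (w i 0)%:P = 0.
  apply: (@poly_closed_eq0 _ _ 'X); first by rewrite polyX_eq0.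
  move=> s; rewrite hornerX => s_neq0.
  have := rE s s_neq0; rewrite (tw _ (cochar_torus s_neq0)).
  move/(scalerI (chi_neq0 _ s_neq0))/colP/(_ i).
  by rewrite !mxE /horner_eval hornerD hornerN hornerC => ->; rewrite subrr.
have /colP/(_ i) := r0; move/eqP: q0; rewrite subr_eq0 => /eqP ri.
by rewrite !mxE /horner_eval ri hornerC.
Qed.

End HighestWeight.

(** * The highest weight matrix coefficient *)

Section Wedge.
Variables (K : fieldType) (n : nat) (J : 'M[K]_n).
Hypothesis (J_nondeg : nondegenerate_mx J).
Local Notation bf := (bform J).

Definition wedge (u v : 'cV[K]_n) : 'M[K]_n := (u *m v^T - v *m u^T) *m J.

Definition conj_act g (S : 'M[K]_n) := g *m S *m form_adj J g.

Lemma conj_act_wedge g u v : conj_act g (wedge u v) = wedge (g *m u) (g *m v).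
Proof.
rewrite /conj_act /wedge /form_adj !mulmxA mulmxK //.
by rewrite mulmxBr mulmxBl !trmx_mul !mulmxA.
Qed.

Lemma wedge_apply u v x : wedge u v *m x = bf v x *: u - bf u x *: v.
Proof.
rewrite /wedge !mulmxBl -!(mulmxA _ J) -!(mulmxA _ _^T) !(mulmxA _^T).
by rewrite !mulmx_bform !mul_mx_scalar.
Qed.

End Wedge.

Section MatrixCoefficient.
Variables (K : closedFieldType) (n : nat) (J : 'M[K]_n).
Hypotheses (J_alt : alternating_mx J) (J_nondeg : nondegenerate_mx J).
Local Notation bf := (bform J).
Variable B : 'M[K]_n.
Hypothesis B_basis : symplectic_basis J B.
Hypothesis n_ge4 : (4 <= n)%N.

Definition ix0 : 'I_n := Ordinal (leq_trans (isT : 0 < 4)%N n_ge4).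
Definition ix1 : 'I_n := Ordinal (leq_trans (isT : 1 < 4)%N n_ge4).

Definition hw_vector := wedge J (col ix0 B) (col ix1 B).

(** The coefficient of S at [hw_vector], obtained by pairing with the last two basis vectors. On the
    orbit of [hw_vector] it is the upper left 2 x 2 minor, whose value on the big cell is the weight
    varpi_2 of the torus part. *)
Definition lowest_coord (S : 'M[K]_n) : K :=
  bf (col (rev_ord ix1) B) (S *m col (rev_ord ix0) B).

Definition minor2 (h : 'M[K]_n) : K :=
  h ix0 ix0 * h ix1 ix1 - h ix1 ix0 * h ix0 ix1.

Lemma bform_col i j g : bf (col i B) (g *m col j B)
  = (B^T *m J *m B *m (invmx B *m g *m B)) i j.
Proof.
rewrite !mulmxA mulmxK ?(basis_unit B_basis) // /bform !colE trmx_mul trmx_delta.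
rewrite (_ : _ *m _ = delta_mx 0 i *m (B^T *m J *m g *m B) *m delta_mx j 0);
  last by rewrite !mulmxA.
by rewrite -rowE -colE [LHS]mxE [LHS]mxE.
Qed.

Lemma std_form_mul (i j : 'I_n) (h : 'M[K]_n) : (i < 2)%N ->
  (B^T *m J *m B *m h) (rev_ord i) j = - h i j.
Proof.
move=> lt_i2; rewrite mxE (bigD1 i) //= big1 => [|k neq_ki]; last first.
  rewrite std_form //= (_ : (_ == _) = false) ?mul0r //.
  by apply: contraNF neq_ki => eq_k; apply/eqP/val_inj => /=; have := ltn_ord i;
    have := ltn_ord k; lia.
rewrite addr0 std_form //= (_ : (_ == _)); last by have := ltn_ord i; lia.
by rewrite (_ : (_ < _)%N = false) ?mulN1r //; lia.
Qed.

Lemma lowest_coord_conj g :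
  lowest_coord (conj_act J g hw_vector) = minor2 (invmx B *m g *m B).
Proof.
rewrite conj_act_wedge // /lowest_coord wedge_apply bformBr !bformZr.
rewrite !(bformC J_alt (g *m _)) !bform_col !std_form_mul // /minor2; ring.
Qed.

Lemma minor2_big_cell (l d u : 'M[K]_n) : upper_unipotent l^T -> is_diag_mx d ->
  upper_unipotent u -> minor2 (l *m d *m u) = d ix0 ix0 * d ix1 ix1.
Proof.
move=> uni_l /is_diag_mxP diag_d uni_u.
have duE i j : (d *m u) i j = d i i * u i j.
  rewrite mxE (bigD1 i) //= big1 ?addr0 // => k neq_ki.
  by rewrite diag_d ?mul0r // eq_sym.
have lE (i j : 'I_n) : (i <= j)%N -> l i j = (j == i)%:R.
  by move=> le_ij; rewrite -uni_l // mxE.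
have l0 (X : 'M[K]_n) j : (l *m X) ix0 j = X ix0 j.
  rewrite mxE (bigD1 ix0) //= big1 => [|k neq_k];
    first by rewrite lE // eqxx mul1r addr0.
  by rewrite lE // (negPf neq_k) mul0r.
have l1 (X : 'M[K]_n) j : (l *m X) ix1 j = l ix1 ix0 * X ix0 j + X ix1 j.
  rewrite mxE (bigD1 ix0) //= (bigD1 ix1) //= big1 => [|k /andP[neq_k0 neq_k1]].
    by rewrite [l ix1 ix1]lE // eqxx mul1r addr0.
  rewrite lE ?(negPf neq_k1) ?mul0r // lt0n.
  by apply: contra neq_k0 => /eqP k0; apply/eqP/val_inj.
rewrite -mulmxA /minor2 !l0 !l1 !duE (uni_u ix0 ix0) // (uni_u ix1 ix0) // (uni_u ix1
  ix1) // !eqxx.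
rewrite (_ : (ix1 == ix0) = false) //= mulr1n mulr0n. ring.
Qed.

Lemma weight_eval_varpi2 t : weight_eval B (fundamental_weight 2) t
  = (invmx B *m t *m B) ix0 ix0 * (invmx B *m t *m B) ix1 ix1.
Proof.
rewrite /weight_eval (bigD1 ix0) /=; last by rewrite half_gt0; lia.
rewrite (bigD1 ix1) /=; last by rewrite andbT; lia.
rewrite big1 ?mulr1 // => i /andP[/andP[_ neq_i0] neq_i1].
rewrite /fundamental_weight (_ : (i < 2)%N = false) //.
have i_neq0 : val i != 0%N by apply: contra neq_i0 => /eqP ?; apply/eqP/val_inj.
have i_neq1 : val i != 1%N by apply: contra neq_i1 => /eqP ?; apply/eqP/val_inj.
by move: i_neq0 i_neq1 => /=; lia.
Qed.

Definition form_poly (x y : 'cV[K]_n) : {mpoly K[n * n]} :=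
  \sum_i \sum_j ((x^T *m J) 0 i * y j 0) *: mcoord K i j.

Lemma mxeval_form_poly x y g : mxeval (form_poly x y) g = bf x (g *m y).
Proof.
rewrite mxeval_sum /bform mxE; apply: eq_bigr => i _.
rewrite mxeval_sum [(g *m y) i 0]mxE mulr_sumr; apply: eq_bigr => j _.
by rewrite /mxeval mevalZ -/(mxeval _ _) mxeval_mcoord mulrAC mulrA.
Qed.

Variables (N : nat) (F : 'M[{mpoly K[n * n]}]_N).
Hypothesis F_rat : rational_rep J F.

Lemma linear_fun_mx (f : 'cV[K]_N -> K) (M : 'M[K]_N) y :
  (forall c y z, f (c *: y + z) = c * f y + f z) ->
  f (M *m y) = \sum_i \sum_j (y j 0 * f (delta_mx i 0)) * M i j.
Proof.
move=> flin; rewrite [M *m y]matrix_sum_delta.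
under eq_bigr do rewrite big_ord1.
rewrite functional_sum //; apply: eq_bigr => i _.
by rewrite mxE mulr_suml; apply: eq_bigr => j _; ring.
Qed.

Lemma matrix_coefficient : has_highest_weight J B (fundamental_weight 2) F ->
  exists (w : 'cV[K]_N) (f : 'cV[K]_N -> K),
  [/\ forall c y z, f (c *: y + z) = c * f y + f z, f w != 0 &
    forall g, in_Sp J g ->
      f (poly_map F g *m w) = f w * lowest_coord (conj_act J g hw_vector)].
Proof.
case=> w [w_neq0 uw tw].
have [f [flin fw fu]] := lowest_functional J_nondeg B_basis F_rat w_neq0 tw.
exists w, f; split=> // g0 Jg0.
(* The difference of the two coefficients as one polynomial in the entries of g. Each pairing with
   the form is minus an entry of g in the basis B, and the signs cancel in the minor. *)
pose Q := \sum_i \sum_j (w j 0 * f (delta_mx i 0)) *: F i j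
  - f w *: (form_poly (col (rev_ord ix1) B) (col ix1 B)
            * form_poly (col (rev_ord ix0) B) (col ix0 B)
            - form_poly (col (rev_ord ix1) B) (col ix0 B)
            * form_poly (col (rev_ord ix0) B) (col ix1 B)).
have QE g : mxeval Q g = f (poly_map F g *m w) - f w * minor2 (invmx B *m g *m B).
  rewrite /Q /mxeval mevalB mevalZ mevalB !mevalM -!/(mxeval _ _) !mxeval_form_poly.
  rewrite linear_fun_mx // mxeval_sum !bform_col !std_form_mul // /minor2.
  congr (_ - _ * _); last by ring.
  apply: eq_bigr => i _; rewrite mxeval_sum; apply: eq_bigr => j _.
  by rewrite /mxeval mevalZ mxE.
apply/eqP; rewrite -subr_eq0 lowest_coord_conj -QE; apply/eqP.
apply: (big_cell_dense J_alt J_nondeg B_basis) Jg0 => u t v Ju uni_u tor_t uni_v.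
have [Jt diag_t] := tor_t; have [Jv uni_v'] := uni_v.
have Bu := basis_unit B_basis.
have Jut := SpM Ju Jt.
rewrite QE !(rep_apply_mul F_rat) // uw // tw //.
have -> : invmx B *m (u *m t *m v) *m B =
  (invmx B *m u *m B) *m (invmx B *m t *m B) *m (invmx B *m v *m B).
  by rewrite !mulmxA !mulmxK.
rewrite minor2_big_cell // -scalemxAr -weight_eval_varpi2.
have := flin (weight_eval B (fundamental_weight 2) t) (poly_map F u *m w) 0.
have f0 : f 0 = 0 by have := flin (-1) 0 0; rewrite scaler0 addr0 mulN1r addNr.
by rewrite f0 !addr0 => ->; rewrite fu // mulrC subrr.
Qed.

End MatrixCoefficient.

(** * The Lie algebra and the self-adjoint model *)

Section MatrixDifferentials.
Variables (K : fieldType) (n : nat).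
Local Notation poly := {mpoly K[n * n]}.
Implicit Types (X g : 'M[K]_n).

Lemma poly_map_meval m (F : 'M[poly]_m) g :
  poly_map F g = map_mx (meval (fun k => mxvec g 0 k)) F.
Proof. by apply/matrixP => i j; rewrite !mxE. Qed.

Lemma poly_mapM m (F G : 'M[poly]_m) g :
  poly_map (F *m G) g = poly_map F g *m poly_map G g.
Proof. by rewrite !poly_map_meval map_mxM. Qed.

Lemma poly_map_const m (A : 'M[K]_m) g : poly_map (map_mx (@mpolyC (n * n) K) A) g = A.
Proof. by apply/matrixP => i j; rewrite !mxE /mxeval mevalC. Qed.

Lemma differentialM m (F G : 'M[poly]_m) X : differential (F *m G) X =
  differential F X *m poly_map G 1%:M + poly_map F 1%:M *m differential G X.
Proof.
apply/matrixP => i j; rewrite !mxE mxdiff1_sum -big_split.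
by apply: eq_bigr => k _; rewrite mxdiff1M !mxE.
Qed.

Lemma differential_const m (A : 'M[K]_m) X :
  differential (map_mx (@mpolyC (n * n) K) A) X = 0.
Proof. by apply/matrixP => i j; rewrite !mxE mxdiff1C. Qed.

Definition generic_mx : 'M[poly]_n := \matrix_(i, j) mcoord K i j.

Lemma poly_map_generic g : poly_map generic_mx g = g.
Proof. by apply/matrixP => i j; rewrite !mxE mxeval_mcoord. Qed.

Lemma poly_map_generic_tr g : poly_map generic_mx^T g = g^T.
Proof. by apply/matrixP => i j; rewrite !mxE mxeval_mcoord. Qed.

Lemma differential_generic X : differential generic_mx X = X.
Proof. by apply/matrixP => i j; rewrite !mxE mxdiff1_mcoord. Qed.

Lemma differential_generic_tr X : differential generic_mx^T X = X^T.
Proof. by apply/matrixP => i j; rewrite !mxE mxdiff1_mcoord. Qed.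

Definition sandwich (A C : 'M[K]_n) : 'M[poly]_n :=
  generic_mx *m map_mx (@mpolyC (n * n) K) A *m generic_mx^T *m map_mx (@mpolyC (n *
    n) K) C.

Lemma poly_map_sandwich A C g : poly_map (sandwich A C) g = g *m A *m g^T *m C.
Proof. by rewrite /sandwich !poly_mapM !poly_map_const poly_map_generic
  poly_map_generic_tr. Qed.

Lemma differential_sandwich A C X :
  differential (sandwich A C) X = (X *m A + A *m X^T) *m C.
Proof.
rewrite /sandwich !differentialM !differential_const !poly_mapM !poly_map_const.
rewrite differential_generic differential_generic_tr poly_map_generic
  poly_map_generic_tr.
by rewrite trmx1 !mulmx0 !addr0 mul1mx mulmx1.
Qed.

(** The entries of g^T J g - J vanish on Sp(V); their differentials at 1 give the equation. *)
Lemma Lie_Sp (J e : 'M[K]_n) : in_Lie_Sp J e -> e^T *m J = - (J *m e).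
Proof.
move=> e_lie; apply/eqP; rewrite -addr_eq0; apply/eqP.
pose M := generic_mx^T *m map_mx (@mpolyC (n * n) K) J *m generic_mx.
have -> : e^T *m J + J *m e = differential M e.
  rewrite /M !differentialM differential_const !poly_mapM !poly_map_const.
  rewrite differential_generic differential_generic_tr poly_map_generic
    poly_map_generic_tr.
  by rewrite trmx1 mulmx0 addr0 mul1mx mulmx1.
apply/matrixP => i j; rewrite [LHS]mxE [RHS]mxE.
suff : mxdiff1 (M i j - (J i j)%:MP) e = 0 by rewrite mxdiff1B mxdiff1C subr0.
apply: e_lie => g Jg; rewrite /mxeval mevalB mevalC -/(mxeval _ _).
have -> : mxeval (M i j) g = poly_map M g i j by rewrite [RHS]mxE.
by rewrite /M !poly_mapM poly_map_const poly_map_generic poly_map_generic_tr Jg subrr.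
Qed.

End MatrixDifferentials.

Section AdjointInvolution.
Variables (K : fieldType) (n : nat) (J : 'M[K]_n).
Hypotheses (J_alt : alternating_mx J) (J_nondeg : nondegenerate_mx J).
Implicit Types (A C S : 'M[K]_n).

Lemma form_adjM A C : form_adj J (A *m C) = form_adj J C *m form_adj J A.
Proof. by rewrite /form_adj trmx_mul !mulmxA mulmxK. Qed.

Lemma form_adjP c A C : form_adj J (c *: A + C) = c *: form_adj J A + form_adj J C.
Proof. by rewrite /form_adj linearP mulmxDr mulmxDl -scalemxAr -scalemxAl. Qed.

Lemma form_adjD A C : form_adj J (A + C) = form_adj J A + form_adj J C.
Proof. by rewrite -[A]scale1r form_adjP !scale1r. Qed.

Lemma form_adj1 : form_adj J 1%:M = 1%:M.
Proof. by rewrite /form_adj trmx1 mulmx1 mulVmx. Qed.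

Lemma form_adjK A : form_adj J (form_adj J A) = A.
Proof.
have VJ : (invmx J)^T *m J = - 1%:M.
  have {2}-> : J = - J^T by rewrite (J_tr J_alt) opprK.
  by rewrite mulmxN -trmx_mul mulmxV // trmx1.
rewrite /form_adj !trmx_mul trmxK (J_tr J_alt) -!mulmxA VJ !mulmxN mulmx1 !mulNmx.
by rewrite mulmxN opprK mulmxA mulVmx // mul1mx.
Qed.

Lemma tr_form_adj A : \tr (form_adj J A) = \tr A.
Proof. by rewrite /form_adj mxtrace_mulC mulmxA mulmxV // mul1mx mxtrace_tr. Qed.

Lemma bform_form_adj A u v : bform J u (form_adj J A *m v) = bform J (A *m u) v.
Proof. by rewrite /bform /form_adj !mulmxA mulmxK // trmx_mul. Qed.

Lemma ad_form_adj e A : in_Lie_Sp J e -> form_adj J (ad e A) = ad e (form_adj J A).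
Proof.
move/Lie_Sp => eJ; have eV : form_adj J e = - e.
  by rewrite /form_adj -mulmxA eJ mulmxN mulmxA mulVmx // mul1mx.
rewrite /ad -scaleN1r addrC form_adjP !form_adjM eV scaleN1r.
by rewrite mulmxN mulNmx opprK addrC.
Qed.

Lemma form_adj_wedge u v : form_adj J (wedge J u v) = wedge J u v.
Proof.
rewrite /form_adj /wedge trmx_mul (J_tr J_alt) linearB /= !trmx_mul !trmxK.
rewrite !mulmxA mulmxN mulVmx // mulNmx mul1mx opprB.
by [].
Qed.

Lemma tr_mul_wedge A u v :
  \tr (A *m wedge J u v) = bform J v (A *m u) - bform J u (A *m v).
Proof.
rewrite /wedge mulmxA mulmxBr mulmxBl linearB /= !mulmxA.
have trE x y : \tr (A *m x *m y^T *m J) = bform J y (A *m x).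
  by rewrite -(mulmxA _ y^T) mxtrace_mulC trace_mx11.
by rewrite !trE.
Qed.

Lemma conj_actM g h S : conj_act J (g *m h) S = conj_act J g (conj_act J h S).
Proof. by rewrite /conj_act form_adjM !mulmxA. Qed.

Lemma conj_actP g c S T :
  conj_act J g (c *: S + T) = c *: conj_act J g S + conj_act J g T.
Proof. by rewrite /conj_act mulmxDr mulmxDl -scalemxAr -scalemxAl. Qed.

Lemma conj_act_sandwich g S : conj_act J g S = poly_map (sandwich (S *m invmx J) J) g.
Proof. by rewrite poly_map_sandwich /conj_act /form_adj !mulmxA. Qed.

Lemma differential_conj e S : in_Lie_Sp J e ->
  differential (sandwich (S *m invmx J) J) e = ad e S.
Proof.
move/Lie_Sp => eJ; rewrite differential_sandwich mulmxDl -!mulmxA eJ mulVmx //.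
by rewrite mulmx1 mulmxN (mulmxA (invmx J)) mulVmx // mul1mx mulmxN.
Qed.

End AdjointInvolution.

Lemma linear_pred_vspace (K : fieldType) (vT : vectType K) (Q : vT -> Prop) :
  Q 0 -> (forall c x y, Q x -> Q y -> Q (c *: x + y)) ->
  exists V : {vspace vT}, forall x, x \in V <-> Q x.
Proof.
move=> Q0 Qlin; have [V [QV VQ]] := span_pred Q.
by exists V => x; split; [exact: VQ | exact: QV].
Qed.

(** * The correspondence between trace zero self-adjoint matrices and L *)

Section Graph.
Variables (K : closedFieldType) (n : nat) (J : 'M[K]_n).
Hypotheses (J_alt : alternating_mx J) (J_nondeg : nondegenerate_mx J).
Hypothesis two_neq0 : (2%:R : K) != 0.
Variable B : 'M[K]_n.
Hypothesis B_basis : symplectic_basis J B.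
Hypothesis n_ge4 : (4 <= n)%N.
Local Notation bf := (bform J).
Local Notation i0 := (ix0 n_ge4).
Local Notation i1 := (ix1 n_ge4).
Local Notation S0 := (hw_vector J B n_ge4).
Local Notation lc := (lowest_coord J B n_ge4).

Definition primitive_part (S : 'M[K]_n) := form_adj J S = S /\ \tr S = 0.

Lemma basis_isotropic (i j : 'I_n) : i != j -> (i + j != n.-1)%N ->
  isotropic_pair J (col i B) (col j B).
Proof.
have Bu := basis_unit B_basis => neq_ij ij; split; last first.
- have := bform_col B_basis i j 1%:M; rewrite mul1mx mulmx1 mulVmx // mulmx1 => ->.
  by rewrite std_form // (negPf ij).
- move=> c; rewrite !colE scalemxAr => /(congr1 (mulmx (invmx B))).
  rewrite !mulKmx // => /colP/(_ j); rewrite !mxE eqxx eq_sym (negPf neq_ij).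
  by move/eqP; rewrite mulr0 oner_eq0.
- apply/eqP => /(congr1 (mulmx (invmx B))); rewrite colE mulKmx // mulmx0.
  by move/colP/(_ i)/eqP; rewrite !mxE eqxx oner_eq0.
Qed.

Lemma hw_isotropic : isotropic_pair J (col i0 B) (col i1 B).
Proof. by apply: basis_isotropic => //=; lia. Qed.

Lemma lw_isotropic : isotropic_pair J (col (rev_ord i0) B) (col (rev_ord i1) B).
Proof.
apply: basis_isotropic => /=; last by lia.
by rewrite (inj_eq rev_ord_inj).
Qed.

Lemma isotropic_wedge u v : isotropic_pair J u v ->
  exists2 g, in_Sp J g & wedge J u v = conj_act J g S0.
Proof.
move=> iso_uv; have [g [Jg gu gv]] := Sp_transitive_pair J_alt J_nondeg hw_isotropic
  iso_uv.
by exists g => //; rewrite conj_act_wedge // gu gv.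
Qed.

Lemma lc_conjP h c S T :
  lc (conj_act J h (c *: S + T)) = c * lc (conj_act J h S) + lc (conj_act J h T).
Proof.
by rewrite conj_actP /lowest_coord mulmxDl -scalemxAl bformDr bformZr.
Qed.

Lemma lc_conj_scalar h c : in_Sp J h -> lc (conj_act J h c%:M) = 0.
Proof.
move=> Jh; rewrite /conj_act mul_mx_scalar -scalemxAl mulmx_form_adj //.
rewrite /lowest_coord -scalemxAl mul1mx bformZr bformC //.
by have [_ _ ->] := lw_isotropic; rewrite oppr0 mulr0.
Qed.

(** Translating the lowest pair of basis vectors reaches every isotropic pair, so the hypothesis is
    that of [isotropic_scalar]. *)
Lemma lc_conj_eq0 S : form_adj J S = S ->
  (forall h, in_Sp J h -> lc (conj_act J h S) = 0) -> exists c, S = c%:M.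
Proof.
move=> adjS S0; apply: (isotropic_scalar J_alt J_nondeg) => // [u v|u v iso_uv].
  by rewrite -{1}adjS bform_form_adj.
have [g [Jg gu gv]] := Sp_transitive_pair J_alt J_nondeg lw_isotropic iso_uv.
have := S0 _ (SpV J_nondeg Jg); rewrite /lowest_coord /conj_act form_adjK //.
by rewrite -(mulmxA _ g) gu -(mulmxA (form_adj J g)) bform_form_adj // gv.
Qed.

Variables (N : nat) (F : 'M[{mpoly K[n * n]}]_N).
Hypothesis F_L : is_L J B (fundamental_weight 2) F.
Variable e : 'M[K]_n.
Hypothesis e_lie : in_Lie_Sp J e.

Let vT : vectType K := ('M[K]_n * 'cV[K]_N)%type.

(** In dual form: the wedges of isotropic pairs span the trace zero self-adjoint matrices. A
    functional is the trace against some [Z0]; on self-adjoint S, twice its value is the trace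
    against the self-adjoint [Z], which [isotropic_scalar] shows to be scalar. *)
Lemma selfadjoint_functional_scalar (f : 'M[K]_n -> K) :
  (forall c y z, f (c *: y + z) = c * f y + f z) ->
  (forall u v, isotropic_pair J u v -> f (wedge J u v) = 0) ->
  exists c, forall S, form_adj J S = S -> f S = c * \tr S.
Proof.
move=> flin fw; pose Z0 : 'M[K]_n := \matrix_(i, j) f (delta_mx j i).
have fZ0 S : f S = \tr (Z0 *m S).
  rewrite [S in LHS]matrix_sum_delta pair_big /=.
  rewrite (functional_sum _ (fun p => S p.1 p.2) (fun p => delta_mx p.1 p.2)) //.
  rewrite -(pair_big predT predT (fun i j => S i j * f (delta_mx i j))) /=.
  rewrite exchange_big /mxtrace; apply: eq_bigr => j _.
  by rewrite mxE; apply: eq_bigr => i _; rewrite mxE mulrC.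
pose Z := Z0 + form_adj J Z0.
have adjZ : form_adj J Z = Z by rewrite form_adjD // form_adjK // addrC.
have trZ S : form_adj J S = S -> \tr (Z *m S) = 2%:R * f S.
  move=> adjS; rewrite mulmxDl linearD /= fZ0 -{2}adjS -form_adjM // tr_form_adj //.
  by rewrite (mxtrace_mulC S); ring.
have bfZ u v : bf u (Z *m v) = bf (Z *m u) v by rewrite -{1}adjZ bform_form_adj.
have [||c Zc] := isotropic_scalar J_alt J_nondeg two_neq0 (Z := Z).
- exact: bfZ.
- move=> u v iso_uv; have := trZ _ (form_adj_wedge J_alt J_nondeg u v).
  rewrite fw // mulr0 tr_mul_wedge (bfZ u v) (bformC J_alt (Z *m u)) opprK -mulr2n
    -mulr_natl.
  by move/eqP; rewrite mulf_eq0 (negPf two_neq0) => /eqP.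
exists (c / 2%:R) => S adjS; have := trZ S adjS.
rewrite Zc mul_scalar_mx mxtraceZ => trS.
by rewrite mulrAC trS mulrAC divff // mul1r.
Qed.

(** [U] is the span of the orbit of the pair of highest weight vectors. Irreducibility of L gives
    the clauses on y, and transitivity on isotropic pairs those on S. Together they present L as P0
    modulo its scalars, compatibly with e. *)
Lemma primitive_graph : exists U : {vspace vT},
  [/\ forall S, (exists y, (S, y) \in U) <-> primitive_part S,
      forall y, exists S, (S, y) \in U,
      forall c y, (c%:M, y) \in U -> y = 0,
      forall S, (S, 0) \in U -> exists c, S = c%:M &
      forall S y, (S, y) \in U -> (ad e S, differential F e *m y) \in U].
Proof.
have [F_rat [N_gt0 F_irr] F_hw] := F_L.
have [w [f [flin fw fE]]] :=
  matrix_coefficient J_alt J_nondeg B_basis n_ge4 F_rat F_hw.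
have f0 : f 0 = 0 by have := flin (-1) 0 0; rewrite scaler0 addr0 mulN1r addNr.
have w_neq0 : w != 0 by apply: contra_neq fw => ->.
have [U [PU UQ]] := span_pred (fun x : vT => exists2 g, in_Sp J g &
  x = (conj_act J g S0, poly_map F g *m w)).
exists U.
(* The equality of matrix coefficients extends linearly from the orbit to its span. *)
have key x : x \in U -> forall h, in_Sp J h ->
    f (poly_map F h *m x.2) = f w * lc (conj_act J h x.1).
  move: x; apply: UQ => [h _|c x y IHx IHy h Jh|_ [g Jg ->] h Jh] /=.
  - by rewrite mulmx0 f0 /conj_act mulmx0 mul0mx /lowest_coord mul0mx /bform mulmx0
    mxE mulr0.
  - rewrite lc_conjP mulmxDr -scalemxAr flin IHx // IHy //; ring.
  - by rewrite -(rep_apply_mul F_rat) // fE ?conj_actM //; exact: SpM.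
have stable x g : in_Sp J g -> x \in U -> (conj_act J g x.1, poly_map F g *m x.2) \in U.
  move=> Jg; move: x; apply: UQ => [|c x y Ux Uy|_ [h Jh ->]] /=.
  - by rewrite mulmx0 /conj_act mulmx0 mul0mx mem0v.
  - have := memvD (memvZ c Ux) Uy; congr (is_true (_ \in U)).
    by rewrite conj_actP mulmxDr -scalemxAr.
  - by apply: PU; exists (g *m h);
    [exact: SpM | rewrite (rep_apply_mul F_rat) // conj_actM].
(* The common kernel of the translates of f is a submodule that does not contain w. *)
have killed y : (forall h, in_Sp J h -> f (poly_map F h *m y) = 0) -> y = 0.
  have [||W WE] := @linear_pred_vspace _ _ (fun y : 'cV[K]_N => forall h,
    in_Sp J h -> f (poly_map F h *m y) = 0).
  - by move=> h _; rewrite mulmx0.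
  - by move=> c x z fx fz h Jh; rewrite mulmxDr -scalemxAr flin fx // fz // mulr0 addr0.
  move/WE; have [g u Jg /WE fu|->|W1] := F_irr W.
  - by apply/WE => h Jh; rewrite -(rep_apply_mul F_rat) // fu //; exact: SpM.
  - by rewrite memv0 => /eqP.
  have /WE/(_ _ (Sp1 J)) : w \in W by rewrite W1 memvf.
  by rewrite (rep_apply1 F_rat) // => /eqP; rewrite (negPf fw).
have prim x : x \in U -> primitive_part x.1.
  move: x; apply: UQ => [|c x y [adjx trx] [adjy try]|_ [g Jg ->]] /=.
  - by split; rewrite ?mxtrace0 // /form_adj trmx0 mulmx0 mul0mx.
  - by split; rewrite ?form_adjP ?adjx ?adjy // mxtraceD mxtraceZ trx try mulr0 addr0.
  - rewrite conj_act_wedge //; split; first exact: form_adj_wedge.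
    rewrite -[wedge _ _ _]mul1mx tr_mul_wedge !mul1mx !bform_Sp // (bformC J_alt (col
      i1 B)).
    by have [_ _ ->] := hw_isotropic; rewrite !oppr0 addr0.
split.
- move=> S; split=> [[y Uy]|[adjS trS]]; first exact: (prim (S, y)).
  have [||V VE] := @linear_pred_vspace _ _ (fun T : 'M[K]_n => exists y, (T, y) \in U).
  + by exists 0; exact: mem0v.
  + move=> c T T' [y Uy] [y' Uy']; exists (c *: y + y').
    exact: memvD (memvZ c Uy) Uy'.
  (* A functional that vanishes on the first projection of [U] kills all isotropic wedges, so it is
     a multiple of the trace and vanishes at S. *)
  apply/VE; apply: contraT => /separating_functional[h [hlin hV hS]].
  have [u v /isotropic_wedge[g Jg ->]|c hE] := selfadjoint_functional_scalar hlin.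
    by apply/hV/VE; exists (poly_map F g *m w); apply: PU; exists g.
  by rewrite hE // trS mulr0 eqxx in hS.
- have [||V VE] := @linear_pred_vspace _ _ (fun y : 'cV[K]_N => exists S, (S, y) \in U).
  + by exists 0; exact: mem0v.
  + move=> c y y' [T Uy] [T' Uy']; exists (c *: T + T').
    exact: memvD (memvZ c Uy) Uy'.
  have [g y Jg /VE[S Uy]|V0|V1] := F_irr V.
  + by apply/VE; exists (conj_act J g S); exact: (stable (S, y)).
  + have : w \in V.
      apply/VE; exists (conj_act J 1%:M S0); apply: PU.
      by exists 1%:M; [exact: Sp1 | rewrite (rep_apply1 F_rat)].
    by rewrite V0 memv0 (negPf w_neq0).
  + by move=> y; apply/VE; rewrite V1 memvf.
- move=> c y Uy; apply: killed => h Jh.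
  by rewrite (key (c%:M, y)) // lc_conj_scalar // mulr0.
- move=> S US; apply: lc_conj_eq0 => [|h Jh]; first by case: (prim (S, 0)).
  have := key _ US h Jh; rewrite mulmx0 f0 => /esym/eqP.
  by rewrite mulf_eq0 (negPf fw) => /eqP.
(* If h vanishes on [U], then g -> h (g (S, y)) is a polynomial vanishing on Sp(V), so its
   differential at 1 in the direction e is 0. *)
- move=> S y Uy; apply: contraT => /separating_functional[h [hlin hU hne]].
  have hE (T : 'M[K]_n) (z : 'cV[K]_N) : h (T, z) =
      \sum_i \sum_j h (delta_mx i j, 0) * T i j + \sum_i h (0, delta_mx i 0) * z i 0.
    have -> : (T, z) = 1 *: (T, 0) + (0, z) :> vT.
      by rewrite scale1r; congr pair; rewrite ?addr0 ?add0r.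
    have h1lin c T1 T2 : h (c *: T1 + T2, 0) = c * h (T1, 0) + h (T2, 0).
      by rewrite -hlin; congr h; congr pair; rewrite /= scaler0 addr0.
    have h2lin c z1 z2 : h (0, c *: z1 + z2) = c * h (0, z1) + h (0, z2).
      by rewrite -hlin; congr h; congr pair; rewrite /= scaler0 addr0.
    rewrite hlin mul1r; congr (_ + _).
      rewrite {1}[T]matrix_sum_delta pair_big /=.
      rewrite (functional_sum _ (fun p => T p.1 p.2) (fun p => delta_mx p.1 p.2) h1lin).
      by rewrite [RHS]pair_big; apply: eq_bigr => p _; rewrite mulrC.
    rewrite {1}[z]matrix_sum_delta; under eq_bigr do rewrite big_ord1.
    by rewrite (functional_sum _ _ _ h2lin); apply: eq_bigr => i _; rewrite mulrC.
  pose C := sandwich (S *m invmx J) J.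
  pose Q := \sum_i \sum_j h (delta_mx i j, 0) *: C i j
    + \sum_i h (0, delta_mx i 0) *: \sum_j y j 0 *: F i j.
  have QE g : mxeval Q g = h (conj_act J g S, poly_map F g *m y).
    rewrite hE conj_act_sandwich // /mxeval mevalD -!/(mxeval _ _) !mxeval_sum.
    congr (_ + _); apply: eq_bigr => i _.
      rewrite mxeval_sum; apply: eq_bigr => j _.
      by rewrite /mxeval mevalZ [poly_map _ _ _ _]mxE.
    rewrite /mxeval mevalZ -/(mxeval _ _) mxeval_sum mxE; congr (_ * _).
    by apply: eq_bigr => j _; rewrite /mxeval mevalZ mxE mulrC.
  have Q1 : mxdiff1 Q e = h (ad e S, differential F e *m y).
    rewrite hE -(differential_conj J_nondeg S e_lie) mxdiff1D !mxdiff1_sum.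
    congr (_ + _); apply: eq_bigr => i _.
      rewrite mxdiff1_sum; apply: eq_bigr => j _.
      by rewrite mxdiff1Z [differential _ _ _ _]mxE.
    rewrite mxdiff1Z mxdiff1_sum mxE; congr (_ * _).
    by apply: eq_bigr => j _; rewrite mxdiff1Z mxE mulrC.
  rewrite -Q1 e_lie ?eqxx // in hne => g Jg.
  by rewrite QE hU // (stable (S, y)).
Qed.
End Graph.

(** * Powers of the commutator map *)

Section IteratedAd.
Variables (K : fieldType) (n : nat).
Implicit Types (e S T : 'M[K]_n).

Lemma adP e c S T : ad e (c *: S + T) = c *: ad e S + ad e T.
Proof.
rewrite /ad mulmxDr mulmxDl -scalemxAr -scalemxAl scalerBr opprD.
by rewrite addrACA.
Qed.

Lemma iter_adP e k c S T :
  iter k (ad e) (c *: S + T) = c *: iter k (ad e) S + iter k (ad e) T.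
Proof. by elim: k => //= k ->; rewrite adP. Qed.

Lemma iter_adD e k S T : iter k (ad e) (S + T) = iter k (ad e) S + iter k (ad e) T.
Proof. by rewrite -[S]scale1r iter_adP !scale1r. Qed.

Lemma iter_ad0 e k : iter k (ad e) 0 = 0.
Proof. by elim: k => //= k ->; rewrite /ad mulmx0 mul0mx subrr. Qed.

Lemma iter_adE e k T : iter k (ad e) T =
  \sum_(i < k.+1) ((-1) ^+ i * 'C(k, i)%:R) *: (e ^+ (k - i) *m T *m e ^+ i).
Proof.
elim: k => [|k IHk]; first by rewrite big_ord1 !expr0 bin0 mulr1 scale1r mul1mx mulmx1.
rewrite iterS {}IHk /ad mulmx_sumr mulmx_suml.
rewrite [RHS]big_ord_recl /= bin0 expr0 mulr1 scale1r expr0 mulmx1 subn0.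
rewrite [X in _ = _ + X](eq_bigr (fun i : 'I_k.+1 =>
    ((-1) ^+ i.+1 * 'C(k, i.+1)%:R) *: (e ^+ (k - i) *m T *m e ^+ i.+1)
    + ((-1) ^+ i.+1 * 'C(k, i)%:R) *: (e ^+ (k - i) *m T *m e ^+ i.+1))); last first.
  by move=> i _; rewrite /bump /= add1n binS natrD mulrDr scalerDl subSS.
rewrite big_split /= addrA; congr (_ + _); last first.
  rewrite -sumrN; apply: eq_bigr => i _.
  rewrite -scalemxAl -scaleNr exprS mulN1r mulNr; congr (_ *: _).
  by rewrite exprSr -[RHS]/(_ *m (_ *m _)) mulmxA.
rewrite big_ord_recl /= bin0 expr0 mulr1 scale1r expr0 mulmx1 subn0.
rewrite mulmxA -[e *m e ^+ k]/(e * e ^+ k) -exprS; congr (_ + _).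
rewrite [RHS]big_ord_recr /= [in X in _ + X]bin_small // mulr0 scale0r addr0.
apply: eq_bigr => i _; rewrite /bump /= add1n -scalemxAr !mulmxA;
  congr (_ *: (_ *m _ *m _)).
by rewrite -[e *m _]/(e * _) -exprS; congr (_ ^+ _); have := ltn_ord i; lia.
Qed.

Lemma iter_ad_nilpotent e m T : e ^+ m = 0 -> iter (m + m) (ad e) T = 0.
Proof.
move=> em; rewrite iter_adE big1 // => i _.
have e0 j : (m <= j)%N -> e ^+ j = 0.
  by move=> le_mj; rewrite -(subnKC le_mj) exprD em mul0r.
have [le_mi|lt_im] := leqP m i; first by rewrite (e0 i) // mulmx0 scaler0.
by rewrite (e0 (m + m - i)%N) ?mul0mx ?scaler0 //; lia.
Qed.

(** In the binomial expansion the inner coefficients vanish in K, and the last sign is -1 as p^a is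
    odd. *)
Lemma iter_ad_pchar p a e T : p \in [pchar K] -> odd p ->
  iter (p ^ a) (ad e) T = ad (e ^+ (p ^ a)) T.
Proof.
move=> charK odd_p; have q_gt0 : (0 < p ^ a)%N by rewrite expn_gt0 (prime_gt0
  (pcharf_prime charK)).
have odd_q : odd (p ^ a) by rewrite oddX odd_p orbT.
have bin0q i : (0 < i < p ^ a)%N -> 'C(p ^ a,
  i)%:R = 0 :> K := bin_pchar_eq0 charK (dvdnn _).
case: (p ^ a)%N q_gt0 odd_q bin0q => // q _ odd_q bin0q.
rewrite iter_adE big_ord_recl big_ord_recr /= big1 => [|i _]; last first.
  rewrite /bump /= add1n bin0q ?mulr0 ?scale0r //.
  by have := ltn_ord i; lia.
rewrite bin0 expr0 mulr1 scale1r expr0 mulmx1 subn0 add0r /bump /= add1n.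
rewrite binn mulr1 subnn expr0 mul1mx -signr_odd odd_q expr1 scaleN1r.
by [].
Qed.

Lemma tr_mul_iter_ad e k S T :
  \tr (T *m iter k (ad e) S) = (-1) ^+ k * \tr (iter k (ad e) T *m S).
Proof.
elim: k S T => [|k IHk] S T; first by rewrite mul1r.
by rewrite iterS tr_mul_ad IHk [in RHS]iterSr exprS mulN1r mulNr.
Qed.

End IteratedAd.

Section LinearAlgebra.
Variable K : fieldType.

Lemma lfun_of_linear (U V : vectType K) (f : U -> V) :
  (forall c x y, f (c *: x + y) = c *: f x + f y) ->
  exists F : 'Hom(U, V), forall x, F x = f x.
Proof.
move=> flin; pose mF := GRing.isLinear.Build K U V *:%R f flin.
pose F : {linear U -> V} := HB.pack f mF.
by exists (linfun F) => x; rewrite lfunE.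
Qed.

(** [col_base A] maps a space of dimension [\rank A] isomorphically onto the image. *)
Lemma dim_limg_mulmx m n (A : 'M[K]_(m, n)) (g : 'Hom('cV[K]_n, 'cV[K]_m)) :
  (forall y, g y = A *m y) -> \dim (limg g) = \rank A.
Proof.
move=> gE; have [h hE] := @lfun_of_linear 'cV[K]_(\rank A) 'cV[K]_m (mulmx (col_base A))
  (fun c x y => linearP (mulmx (col_base A)) c x y).
have -> : limg g = limg h.
  apply/eqP; rewrite eqEsubv; apply/andP; split; apply/subvP => _ /memv_imgP[y _ ->].
    rewrite gE -[A in A *m y]mulmx_base -mulmxA -hE; exact: memv_img (memvf _).
  have /row_freeP[D rD] := row_base_free A.
  rewrite hE -[y]mul1mx -rD -[row_base A *m D *m y]mulmxA mulmxA mulmx_base -gE.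
  exact: memv_img (memvf _).
have hker : (fullv :&: lker h = 0)%VS.
  apply/eqP; rewrite -subv0; apply/subvP => y.
  rewrite memv_cap memv_ker hE => /andP[_ /eqP y0].
  have /row_fullP[D Dc] := col_base_full A.
  by rewrite memv0 -[y]mul1mx -Dc -mulmxA y0 mulmx0.
by rewrite (limg_dim_eq hker) dimvf dim_matrix; exact: muln1.
Qed.

End LinearAlgebra.

(** * The exterior square as skew-symmetric matrices *)

Section ExteriorSquareModel.
Variables (K : fieldType) (n : nat).
Implicit Types (X e : 'M[K]_n).
Local Notation M := #|{: ltpair n}|.
Implicit Types (v : 'cV[K]_M).

Definition pair1 (a : 'I_M) : 'I_n := (val (enum_val a)).1.
Definition pair2 (a : 'I_M) : 'I_n := (val (enum_val a)).2.

Lemma pair_lt a : (pair1 a < pair2 a)%N.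
Proof. exact: valP (enum_val a). Qed.

Lemma pair_eq a b : pair1 a = pair1 b -> pair2 a = pair2 b -> a = b.
Proof.
rewrite /pair1 /pair2 => eq1 eq2; apply/enum_val_inj/val_inj.
by case: (val _) (val _) eq1 eq2 => [i j] [k l] /= -> ->.
Qed.

Lemma pairP (i j : 'I_n) : (i < j)%N -> exists a, pair1 a = i /\ pair2 a = j.
Proof.
move=> lt_ij; exists (enum_rank (Sub (i, j) lt_ij : ltpair n)).
by rewrite /pair1 /pair2 enum_rankK SubK.
Qed.

Definition skew_unit a : 'M[K]_n :=
  delta_mx (pair1 a) (pair2 a) - delta_mx (pair2 a) (pair1 a).

Definition skew_of v : 'M[K]_n := \sum_a v a 0 *: skew_unit a.

Definition coords X : 'cV[K]_M := \col_a X (pair1 a) (pair2 a).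

Lemma skew_unitE a b : skew_unit a (pair1 b) (pair2 b) = (a == b)%:R.
Proof.
rewrite !mxE.
have -> : (pair1 b == pair2 a) && (pair2 b == pair1 a) = false.
  apply/negP => /andP[/eqP e1 /eqP e2]; have := pair_lt a; have := pair_lt b.
  by rewrite e1 e2; lia.
rewrite subr0; congr (_%:R); congr nat_of_bool;
  apply/andP/eqP => [[/eqP e1 /eqP e2]|->].
  by apply: pair_eq.
by [].
Qed.

Lemma coords_skew_of v : coords (skew_of v) = v.
Proof.
apply/colP => a; rewrite mxE /skew_of summxE (bigD1 a) //= big1 => [|b neq_ba].
  by rewrite mxE skew_unitE eqxx mulr1 addr0.
by rewrite mxE skew_unitE (negPf neq_ba) mulr0.
Qed.

Lemma skew_unit_tr a : (skew_unit a)^T = - skew_unit a.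
Proof. by rewrite /skew_unit linearB /= !trmx_delta opprB. Qed.

Lemma skew_of_tr v : (skew_of v)^T = - skew_of v.
Proof.
rewrite /skew_of linear_sum -sumrN; apply: eq_bigr => a _ /=.
by rewrite linearZ /= skew_unit_tr scalerN.
Qed.

Lemma skew_ofP c v w : skew_of (c *: v + w) = c *: skew_of v + skew_of w.
Proof.
rewrite /skew_of scaler_sumr -big_split; apply: eq_bigr => a _ /=.
by rewrite !mxE scalerDl scalerA.
Qed.

Hypothesis two_neq0 : (2%:R : K) != 0.

Lemma skew_coords_inj X Y :
  X^T = - X -> Y^T = - Y -> coords X = coords Y -> X = Y.
Proof.
move=> skX skY eqXY.
have lt (i j : 'I_n) : (i < j)%N -> X i j = Y i j.
  by case/pairP => a [<- <-]; move/colP/(_ a): eqXY; rewrite !mxE.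
have tr (Z : 'M[K]_n) i j : Z^T = - Z -> Z i j = - Z j i.
  by move/matrixP/(_ j i); rewrite !mxE.
apply/matrixP => i j; case: (ltngtP i j) => [/lt //|/lt eq_ji|/val_inj <-].
  by rewrite (tr X) // (tr Y) // eq_ji.
have diag (Z : 'M[K]_n) : Z^T = - Z -> Z i i = 0.
  move/tr => /(_ i i)/eqP; rewrite -addr_eq0 -mulr2n -mulr_natl mulf_eq0.
  by rewrite (negPf two_neq0) => /eqP.
by rewrite !diag.
Qed.

Lemma skew_of_coords X : X^T = - X -> skew_of (coords X) = X.
Proof.
by move=> skX; apply: skew_coords_inj (skew_of_tr _) skX (coords_skew_of _).
Qed.

(** The differential of X -> g X g^T at g = 1, in the direction e. *)
Definition derivation e X := e *m X + X *m e^T.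

Lemma derivation_tr e X : X^T = - X -> (derivation e X)^T = - derivation e X.
Proof.
move=> skX; rewrite /derivation linearD /= !trmx_mul trmxK skX.
by rewrite mulNmx mulmxN addrC opprD.
Qed.

Lemma derivation_skew_unit e a b :
  derivation e (skew_unit b) (pair1 a) (pair2 a) = differential (ext2 K n) e a b.
Proof.
have mul_deltal (Y : 'M[K]_n) i j k l : (Y *m delta_mx i j) k l = Y k i * (j == l)%:R.
  rewrite mxE (bigD1 i) //= big1 => [|m neq_mi]; first by rewrite mxE eqxx addr0 eq_sym.
  by rewrite mxE (negPf neq_mi) mulr0.
have mul_deltar (Y : 'M[K]_n) i j k l : (delta_mx i j *m Y) k l = (i == k)%:R * Y j l.
  rewrite mxE (bigD1 j) //= big1 => [|m neq_mj];
    first by rewrite mxE eqxx andbT addr0 eq_sym.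
  by rewrite mxE (negPf neq_mj) andbF mul0r.
rewrite /derivation /skew_unit mulmxBr mulmxBl [LHS]mxE [X in X + _]mxE [X in _ + X]mxE.
rewrite [X in _ + (_ + X)]mxE [X in (_ + X) + _]mxE !mul_deltal !mul_deltar !mxE.
rewrite /pair1 /pair2; case: (val (enum_val a)) => k l;
  case: (val (enum_val b)) => i j /=.
rewrite mxdiff1B !mxdiff1M !mxdiff1_mcoord !mxeval_mcoord !mxE.
by rewrite !(eq_sym k) !(eq_sym l); ring.
Qed.

Lemma skew_of_differential e v :
  skew_of (differential (ext2 K n) e *m v) = derivation e (skew_of v).
Proof.
apply: skew_coords_inj; first exact: skew_of_tr.
  exact/derivation_tr/skew_of_tr.
rewrite coords_skew_of; apply/colP => a; rewrite [RHS]mxE.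
have -> : derivation e (skew_of v) = \sum_b v b 0 *: derivation e (skew_unit b).
  rewrite /derivation /skew_of mulmx_sumr mulmx_suml -big_split;
    apply: eq_bigr => b _ /=.
  by rewrite -scalemxAr -scalemxAl scalerDr.
rewrite mxE summxE; apply: eq_bigr => b _.
by rewrite [RHS]mxE derivation_skew_unit mulrC.
Qed.

(** The induced actions of e and D have as commutator the induced action of [e, D] = 1, and the
    identity of V acts on the exterior square as 2. *)
Lemma ad_differential_ext2 e D : ad e D = 1%:M ->
  ad (differential (ext2 K n) e) (2%:R^-1 *: differential (ext2 K n) D) = 1%:M.
Proof.
move=> eD; pose d e := differential (ext2 K n) e.
have dd : ad (d e) (d D) = 2%:R *: 1%:M.
  apply/matrixP => a b;
    have col_delta (C : 'M[K]_M) : C a b = (C *m delta_mx b 0 : 'cV_M) a 0.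
    by rewrite -colE mxE.
  rewrite col_delta [RHS]col_delta; congr (fun_of_matrix _ a 0);
    rewrite -[LHS]coords_skew_of -[RHS]coords_skew_of.
  congr coords; rewrite -scalemxAl mul1mx -[2%:R *: _]addr0 skew_ofP.
  have skew0 : skew_of 0 = 0 by rewrite /skew_of big1 // => c _; rewrite mxE scale0r.
  rewrite skew0 addr0 /ad mulmxBl -!mulmxA.
  rewrite -scaleN1r addrC skew_ofP !skew_of_differential scaleN1r.
  move: (skew_of _) => X; rewrite /derivation !mulmxDr !mulmxDl !mulmxA.
  have -> : 2%:R *: X = ad e D *m X + X *m (ad e D)^T.
    by rewrite eD trmx1 mul1mx mulmx1 scaler_nat mulr2n.
  rewrite /ad linearB /= !trmx_mul mulmxBl mulmxBr !mulmxA.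
  have aux (V : zmodType) (r s t u x y : V) :
    r + s + (t + u) - (x + t + (s + y)) = r - x + (u - y).
    rewrite (addrC t u) (addrACA r) (addrC s y) (addrACA x) (addrC t s).
    by rewrite opprD (addrACA (r + u)) subrr addr0 opprD addrACA.
  rewrite [LHS]addrC; exact: aux.
by rewrite /ad -scalemxAr -scalemxAl -scalerBr -/(ad _ _) dd scalerA mulVf // scale1r.
Qed.

End ExteriorSquareModel.

(** * Comparison of ranks *)

Lemma dim_cap_vline (K : fieldType) (vT : vectType K) (V : {vspace vT}) x :
  x != 0 -> \dim (V :&: <[x]>) = (x \in V).
Proof.
move=> x_neq0; case: (boolP (x \in V)) => [Vx|notVx].
  by rewrite (capv_idPr _) ?dim_vline ?x_neq0 // -memvE.
have -> : (V :&: <[x]> = 0)%VS; last by rewrite dimv0.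
apply/eqP; rewrite -subv0; apply/subvP => y;
  rewrite memv_cap => /andP[Vy /vlineP[c def_y]].
rewrite memv0 def_y scaler_eq0 (negPf x_neq0) orbF; apply: contraNT notVx => c_neq0.
by have := memvZ c^-1 Vy; rewrite def_y scalerA mulVf // scale1r.
Qed.

Section RankComparison.
Variables (K : closedFieldType) (n : nat) (J : 'M[K]_n).
Hypotheses (J_alt : alternating_mx J) (J_nondeg : nondegenerate_mx J).
Hypothesis two_neq0 : (2%:R : K) != 0.
Variable B : 'M[K]_n.
Hypothesis B_basis : symplectic_basis J B.
Hypothesis n_ge4 : (4 <= n)%N.
Variables (N : nat) (F : 'M[{mpoly K[n * n]}]_N).
Hypothesis F_L : is_L J B (fundamental_weight 2) F.
Variable e : 'M[K]_n.
Hypothesis e_lie : in_Lie_Sp J e.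

Local Notation e0 := (differential (ext2 K n) e).
Local Notation e0'' := (differential F e).

Variables (pp P0 : {vspace 'M[K]_n}).
Hypothesis ppE : forall S, S \in pp <-> form_adj J S = S.
Hypothesis P0E : forall S, S \in P0 <-> primitive_part J S.
Variables (k : nat) (Ak : 'End('M[K]_n)).
Hypothesis AkE : forall S, Ak S = iter k (ad e) S.

(** [iota] maps the exterior square isomorphically onto pp and carries e0 to [ad e], since e^T J = -
    J e. *)
Lemma rank_expr_ext2 : \rank (e0 ^+ k) = \dim (Ak @: pp).
Proof.
have [iota iotaE] := lfun_of_linear (f := fun v => skew_of v *m J) (fun c v w =>
  etrans (congr1 (mulmx^~ J) (skew_ofP c v w)) (linearP (mulmxr J) c _ _)).
have [g gE] := lfun_of_linear (f := mulmx (e0 ^+ k) : 'cV_ _ -> 'cV_ _) (fun c v w =>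
  linearP (mulmx _) c v w).
have skew_iota v : (iota v *m invmx J)^T = - (iota v *m invmx J).
  by rewrite iotaE mulmxK // skew_of_tr.
have iota_im : limg iota = pp.
  apply/eqP; rewrite eqEsubv; apply/andP; split; apply/subvP => S.
    move=> /memv_imgP[v _ ->]; apply/ppE;
      rewrite iotaE /form_adj trmx_mul skew_of_tr (J_tr J_alt).
    by rewrite mulmxN mulNmx opprK !mulmxA mulVmx // mul1mx.
  move=> /ppE adjS; have SJ : S^T *m J = J *m S.
    by rewrite -{2}adjS /form_adj !mulmxA mulmxV // mul1mx.
  pose X := S *m invmx J.
  have skX : X^T = - X.
    apply: (can_inj (mulmxK J_nondeg)); rewrite /X trmx_mul mulNmx mulmxKV //.
    rewrite -mulmxA SJ mulmxA; have {2}-> : J = - J^T by rewrite (J_tr J_alt) opprK.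
    by rewrite mulmxN -trmx_mul mulmxV // trmx1 mulNmx mul1mx.
  have -> : S = iota (coords X) by rewrite iotaE skew_of_coords // mulmxKV.
  exact: memv_img (memvf _).
have iota_g v : iota (g v) = Ak (iota v).
  rewrite gE AkE !iotaE; elim: (k) => [|j IHj]; first by rewrite expr0 mul1mx.
  rewrite exprS -[_ * _]/(_ *m _) -mulmxA skew_of_differential // iterS -IHj.
  by rewrite /derivation /ad mulmxDl -(mulmxA _ e^T) Lie_Sp // mulmxN !mulmxA.
have iota_ker V : (V :&: lker iota = 0)%VS.
  apply/eqP; rewrite -subv0; apply/subvP => v; rewrite memv_cap memv_ker memv0 iotaE.
  move=> /andP[_ /eqP vJ0]; rewrite -[v]coords_skew_of -[skew_of v](mulmxK J_nondeg).
  by rewrite vJ0 mul0mx; apply/eqP/colP => a; rewrite !mxE.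
rewrite -(dim_limg_mulmx gE) -(limg_dim_eq (iota_ker _)) -iota_im -!limg_comp.
by congr (\dim (lfun_img _ _)); apply/lfunP => v; rewrite !comp_lfunE iota_g.
Qed.

(** Let [X] act on the correspondence [U] by (ad e)^k and e0''^k. The first projection is injective
    on [U] and maps X U onto the image of P0. The second maps X U onto the image of e0''^k, and its
    kernel there corresponds to the scalars in the image of P0; the boolean is the dimension of that
    kernel. *)
Lemma rank_expr_L : (\rank (e0'' ^+ k) + (1%:M \in Ak @: P0)%VS = \dim (Ak @: P0))%N.
Proof.
have [U [U_prim U_surj U_scalar U_ker U_stable]] :=
  primitive_graph J_alt J_nondeg two_neq0 B_basis n_ge4 F_L e_lie.
pose vT : vectType K := ('M[K]_n * 'cV[K]_N)%type.
have [X XE] : exists X : 'End(vT), forall x, X x = (Ak x.1, e0'' ^+ k *m x.2).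
  apply: lfun_of_linear => c x y; congr pair => /=; first by rewrite linearP.
  by rewrite mulmxDr -scalemxAr.
have [p1 p1E] : exists p1 : 'Hom(vT, 'M[K]_n), forall x,
  p1 x = x.1 by apply: lfun_of_linear.
have [p2 p2E] : exists p2 : 'Hom(vT, 'cV[K]_N), forall x,
  p2 x = x.2 by apply: lfun_of_linear.
have [g gE] := lfun_of_linear (f := mulmx (e0'' ^+ k) : 'cV_ _ -> 'cV_ _) (fun c v w
  => linearP (mulmx _) c v w).
have XU : (X @: U <= U)%VS.
  apply/subvP => _ /memv_imgP[[S y] Uy ->]; rewrite XE AkE /=.
  elim: (k) => [|j IHj]; first by rewrite expr0 mul1mx.
  by rewrite exprS -[_ * _]/(_ *m _) -mulmxA; apply: U_stable.
have p1U : (p1 @: U = P0)%VS.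
  apply/vspaceP => S; apply/memv_imgP/idP => [[[T y] Uy ->]|/P0E/U_prim[y Uy]].
    by rewrite p1E; apply/P0E/U_prim; exists y.
  by exists (S, y); rewrite ?p1E.
have p2U : (p2 @: U = fullv)%VS.
  apply/vspaceP => y; rewrite memvf; apply/memv_imgP.
  by have [S Uy] := U_surj y; exists (S, y); rewrite ?p2E.
have p1XU : (p1 @: (X @: U) = Ak @: P0)%VS.
  rewrite -p1U -!limg_comp; congr (lfun_img _ _).
  by apply/lfunP => x; rewrite !comp_lfunE !p1E XE.
have p2XU : (p2 @: (X @: U) = limg g)%VS.
  rewrite -p2U -!limg_comp; congr (lfun_img _ _).
  by apply/lfunP => x; rewrite !comp_lfunE !p2E XE gE.
have p1_inj V : (V <= U)%VS -> \dim (p1 @: V) = \dim V.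
  move=> VU; apply: limg_dim_eq; apply/eqP; rewrite -subv0; apply/subvP => -[S y].
  rewrite memv_cap memv_ker memv0 p1E /= => /andP[/(subvP VU) Uy /eqP S0].
  move: Uy; rewrite S0 => Uy; apply/eqP; congr pair; apply: (U_scalar 0).
  by rewrite raddf0.
rewrite -p1XU (p1_inj _ XU) -(limg_ker_dim p2) p2XU (dim_limg_mulmx gE) addnC.
congr (_ + _)%N; rewrite p1XU -dim_cap_vline; last first.
  have n_gt0 : (0 < n)%N by apply: leq_trans n_ge4.
  apply/eqP => /matrixP/(_ (Ordinal n_gt0) (Ordinal n_gt0))/eqP.
  by rewrite !mxE eqxx oner_eq0.
rewrite -[RHS]p1_inj; last by apply: subv_trans XU; exact: capvSl.
congr (\dim _); apply/vspaceP => S; apply/idP/memv_imgP.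
  rewrite -p1XU memv_cap => /andP[/memv_imgP[[T y] XUy ->]] /vlineP[c].
  rewrite p1E /= => def_T; exists (T, y); last by rewrite p1E.
  rewrite memv_cap XUy memv_ker p2E /=; apply/eqP/(U_scalar c).
  have -> : c%:M = c *: 1%:M :> 'M[K]_n by rewrite scalemx1.
  by rewrite -def_T (subvP XU).
move=> [[T y]]; rewrite memv_cap memv_ker p1E p2E /= => /andP[XUy /eqP y0] ->.
rewrite memv_cap -p1XU; apply/andP; split.
  by rewrite -[T]/((T, y).1) -p1E memv_img.
have [|c ->] := U_ker T; first by rewrite -y0 (subvP XU).
have -> : c%:M = c *: 1%:M :> 'M[K]_n by rewrite scalemx1.
by rewrite memvZ ?memv_line.
Qed.

Hypothesis tr_pp : exists2 T, T \in pp & \tr T != 0.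

Lemma P0_sub_pp : (P0 <= pp)%VS.
Proof. by apply/subvP => S /P0E[adjS _]; apply/ppE. Qed.

(** Neither loss occurs: subtracting multiples of T makes any S trace zero without changing its
    image, and 1 = (ad e)^k S would give tr T = 0 by invariance. *)
Lemma rank_expr_eq T : T \in pp -> \tr T != 0 -> iter k (ad e) T = 0 ->
  \rank (e0'' ^+ k) = \rank (e0 ^+ k).
Proof.
move=> ppT trT kT; have := rank_expr_L; rewrite rank_expr_ext2.
have -> : (1%:M \in Ak @: P0)%VS = false.
  apply: contra_neqF trT => /memv_imgP[S _ oneS].
  by rewrite -[T]mulmx1 oneS AkE tr_mul_iter_ad kT mul0mx mxtrace0 mulr0.
rewrite addn0 => ->; congr (\dim _); apply/eqP; rewrite eqEsubv limgS ?P0_sub_pp //=.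
apply/subvP => _ /memv_imgP[S ppS ->].
have -> : Ak S = Ak (S - (\tr S / \tr T) *: T).
  by rewrite linearB linearZ /= (AkE T) kT scaler0 subr0.
apply/memv_img/P0E; split.
  by apply/ppE; rewrite memvB // memvZ.
by rewrite linearB linearZ /= divfK // subrr.
Qed.

(** P0 has codimension 1 in pp, and (ad e)^k has the same kernel on both, so its images also differ
    by one dimension. *)
Lemma rank_expr_succ : (forall T, T \in pp -> iter k (ad e) T = 0 -> \tr T = 0) ->
  (\rank (e0'' ^+ k) + (1%:M \in Ak @: P0)%VS + 1 = \rank (e0 ^+ k))%N.
Proof.
move=> kT0; rewrite rank_expr_L rank_expr_ext2.
have dim_pp : \dim pp = (\dim P0).+1.
  have [T ppT trT] := tr_pp.
  have -> : pp = (P0 + <[T]>)%VS.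
    apply/eqP; rewrite eqEsubv; apply/andP; split; last first.
      by rewrite subv_add P0_sub_pp -memvE.
    apply/subvP => S ppS; rewrite -[S](subrK ((\tr S / \tr T) *: T)).
    apply: memv_add; last by rewrite memvZ ?memv_line.
    apply/P0E; split; first by apply/ppE; rewrite memvB // memvZ.
    by rewrite linearB linearZ /= divfK // subrr.
  have T_neq0 : T != 0 by apply: contra_neq trT => ->; rewrite mxtrace0.
  have := dimv_sum_cap P0 <[T]>; rewrite dim_vline T_neq0 dim_cap_vline // addn1.
  suff -> : (T \in P0) = false by rewrite addn0.
  by apply: contra_neqF trT => /P0E[].
have ker_eq : (pp :&: lker Ak = P0 :&: lker Ak)%VS.
  apply/vspaceP => S; rewrite !memv_cap; case: (boolP (S \in lker Ak)) => [|_];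
    last by rewrite !andbF.
  rewrite memv_ker AkE !andbT => /eqP kS; apply/idP/idP; last exact: (subvP P0_sub_pp).
  by move=> ppS; apply/P0E; split; [exact/ppE | exact: kT0].
have := limg_ker_dim Ak pp; rewrite ker_eq dim_pp -(limg_ker_dim Ak P0) -addnS.
by move/addnI ->; rewrite addn1.
Qed.

End RankComparison.

(** * From ranks to block sizes *)

Lemma jordan_nilpotent (K : fieldType) n (A : 'M[K]_n) s :
  jordan_block_sizes A s -> exists m, A ^+ m = 0.
Proof.
move=> s_A; exists (\sum_(x <- s) x)%N; apply/eqP; rewrite -mxrank_eq0.
rewrite (rank_jordan _ s_A) big1_seq // => x /andP[_ s_x]; apply/eqP.
by rewrite subn_eq0 (big_rem x) //= leq_addr.
Qed.

Lemma dvdn_biggcd m (s : seq nat) :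
  (m %| \big[gcdn/0]_(x <- s) x)%N = all (fun x => m %| x)%N s.
Proof. by elim: s => [|x s IHs];
  rewrite ?big_nil ?big_cons ?dvdn0 //= dvdn_gcd IHs. Qed.

Lemma gcd_pfactor p (s : seq nat) (q := (p ^ logn p (\big[gcdn/0]_(x <- s) x))%N) :
  prime p -> all (fun x => 0 < x)%N s -> (0 < size s)%N ->
  all (fun x => q %| x)%N s /\ exists2 x, x \in s & ~~ (p %| x %/ q)%N.
Proof.
move=> p_pr s_gt0 s_neq0; pose g := (\big[gcdn/0]_(x <- s) x)%N.
have g_gt0 : (0 < g)%N.
  rewrite lt0n -dvd0n /g dvdn_biggcd.
  case: s s_neq0 s_gt0 {q g} => //= x s _ /andP[x_gt0 _].
  by rewrite dvd0n negb_and -lt0n x_gt0.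
have dvd_q : all (fun x => q %| x)%N s by rewrite -dvdn_biggcd pfactor_dvdnn.
split=> //; apply/hasP; apply: contraT; rewrite -all_predC => /allP dvd_p.
suff : (p ^ (logn p g).+1 %| g)%N by rewrite pfactor_dvdn // ltnn.
rewrite dvdn_biggcd; apply/allP => x s_x; have := dvd_p x s_x; rewrite /= negbK.
have q_x := allP dvd_q x s_x; have q_gt0 : (0 < q)%N by rewrite expn_gt0 prime_gt0.
by rewrite dvdn_divRL // expnS.
Qed.

Lemma iter_ad_form_adj (K : fieldType) n (J e : 'M[K]_n) k A :
  nondegenerate_mx J -> in_Lie_Sp J e ->
  form_adj J (iter k (ad e) A) = iter k (ad e) (form_adj J A).
Proof. by move=> J_nondeg e_lie; elim: k => //= k <-; rewrite ad_form_adj. Qed.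

(** R - R'' is c times the indicator of k < q, whose second difference is 1 at q, -1 at q - 1 and 0
    elsewhere. For q = 1 the size q - 1 does not occur. *)
Lemma second_difference_step (r r'' R R'' : nat -> nat) c q :
  (forall m, 0 < m -> r m + 2 * R m = R m.-1 + R m.+1)%N ->
  (forall m, 0 < m -> r'' m + 2 * R'' m = R'' m.-1 + R'' m.+1)%N ->
  (forall k, k < q -> R'' k + c = R k)%N -> (forall k, q <= k -> R'' k = R k)%N ->
  [/\ (0 < q -> r'' q + c = r q)%N,
      (1 < q -> r'' (q - 1) = r (q - 1) + c)%N
    & forall m, (0 < m)%N -> m <> q -> m <> (q - 1)%N -> r'' m = r m].
Proof.
move=> rE r''E R_lt R_ge; split=> [q_gt0|q_gt1|m m_gt0 neq_q neq_q1].
- have := rE q q_gt0; have := r''E q q_gt0; have Rq : (q.-1 < q)%N by lia.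
  rewrite (R_ge q) // (R_ge q.+1) // -(R_lt _ Rq).
  by clear; lia.
- case: q q_gt1 => [|[|q]] // _ in R_lt R_ge *; rewrite subn1.
  have := rE q.+1 isT; have := r''E q.+1 isT; rewrite (R_ge q.+2) //=.
  have := R_lt q (leqnSn _); have := R_lt q.+1 (leqnn _).
  by clear; lia.
have := rE m m_gt0; have := r''E m m_gt0.
have [lt_mq|lt_qm] : (m.+1 < q)%N \/ (q < m)%N by clear -neq_q neq_q1; lia.
  have := R_lt m.+1 lt_mq; have := R_lt m (ltnW lt_mq).
  have := R_lt m.-1 (leq_ltn_trans (leq_pred m) (ltnW lt_mq)).
  by clear; lia.
rewrite (R_ge m (ltnW lt_qm)) (R_ge m.+1) ?(R_ge m.-1).
- by clear; lia.
- by clear -lt_qm; lia.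
- by clear -lt_qm; lia.
Qed.

Theorem corollary1p4 (K : closedFieldType) (p : nat)
    (charK : p \in [pchar K]) (p_gt2 : (2 < p)%N)
    (n : nat) (n_ge4 : (4 <= n)%N)
    (J : 'M[K]_n) (J_alt : alternating_mx J) (J_nondeg : nondegenerate_mx J)
    (e : 'M[K]_n) (e_lie : in_Lie_Sp J e) (e_nil : nilpotent_elt J e)
    (d : seq nat) (t_ge1 : (1 <= size d)%N) (d_e : jordan_block_sizes e d)
    (B : 'M[K]_n) (B_basis : symplectic_basis J B)
    (N : nat) (L : 'M[{mpoly K[n * n]}]_N)
    (L_varpi2 : is_L J B (fundamental_weight 2) L) :
  let alpha := logn p (\big[gcdn/0%N]_(i <- d) i) in
  let e0 := differential (ext2 K n) e in
  let e0'' := differential L e in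
  let r m := (num_jordan_blocks m e0)%:Z in
  let r'' m := (num_jordan_blocks m e0'')%:Z in
  [/\ (* (iii) *)
      ~~ (p %| n)%N ->
        r'' 1%N = r 1%N - 1 /\
        (forall m : nat, (1 <= m)%N -> m <> 1%N -> r'' m = r m),
      (* (iv) *)
      (p %| n)%N -> alpha = 0%N ->
        r'' 1%N = r 1%N - 2 /\
        (forall m : nat, (1 <= m)%N -> m <> 1%N -> r'' m = r m)
    & (* (v) *)
      (p %| n)%N -> (0 < alpha)%N ->
        [/\ r'' (p ^ alpha)%N = r (p ^ alpha)%N - 2,
            r'' (p ^ alpha - 1)%N = 2
          & forall m : nat, (1 <= m)%N ->
              m <> (p ^ alpha)%N -> m <> (p ^ alpha - 1)%N -> r'' m = r m]].
Proof.
have p_pr := pcharf_prime charK.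
have p_odd : odd p by case: (even_prime p_pr) p_gt2 => [->|].
have two_neq0 : (2%:R : K) != 0 by rewrite -(dvdn_pcharf charK) gtnNdvd.
move=> alpha e0 e0'' r r''; pose q := (p ^ alpha)%N; rewrite -/q.
have q_gt0 : (0 < q)%N by rewrite expn_gt0 prime_gt0.
have [dvd_q [x d_x ndvd_x]] := gcd_pfactor p_pr (proj1 d_e) t_ge1.
rewrite -/alpha -/q in dvd_q ndvd_x.
have [||pp ppE] := @linear_pred_vspace _ _ (fun S : 'M[K]_n => form_adj J S = S).
- by rewrite /form_adj trmx0 mulmx0 mul0mx.
- by move=> c S T adjS adjT; rewrite form_adjP adjS adjT.
have [||P0 P0E] := @linear_pred_vspace _ _ (fun S : 'M[K]_n => primitive_part J S).
- by split; rewrite ?mxtrace0 // /form_adj trmx0 mulmx0 mul0mx.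
- move=> c S T [adjS trS] [adjT trT].
  by split; rewrite ?form_adjP ?adjS ?adjT // linearP /= trS trT mulr0 addr0.
have AkE k := lfun_of_linear (iter_adP e k).
(* Averaging with the adjoint preserves traces and commutes with [ad e], so solutions found among
   all matrices can be made self-adjoint. *)
have pp_half S : 2%:R^-1 *: (S + form_adj J S) \in pp.
  apply/ppE; rewrite -[X in form_adj J X]addr0 form_adjP // form_adjD // form_adjK //.
  by rewrite /form_adj trmx0 mulmx0 mul0mx addr0 addrC.
have half (S : 'M[K]_n) : 2%:R^-1 *: (S + S) = S.
  by rewrite -mulr2n -scaler_nat scalerA mulVf // scale1r.
have tr_half S : \tr (2%:R^-1 *: (S + form_adj J S)) = \tr S.
  by rewrite mxtraceZ mxtraceD tr_form_adj // -(mulr2n (\tr S)) -(mulr_natl (\tr S))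
    mulKf.
have ad_half k S : iter k (ad e) (2%:R^-1 *: (S + form_adj J S)) =
    2%:R^-1 *: (iter k (ad e) S + form_adj J (iter k (ad e) S)).
  by rewrite iter_ad_form_adj // -[_ *: (S + _)]addr0 iter_adP iter_ad0 addr0 iter_adD.
have nil_e0 : nilpotent_mx e0.
  have [m em] := jordan_nilpotent d_e; exists (m + m)%N; rewrite iter_mulmx.
  apply/eqP; rewrite -mxrank_eq0; have [A AE] := AkE (m + m)%N.
  rewrite (rank_expr_ext2 J_alt J_nondeg two_neq0 e_lie ppE AE) dimv_eq0 -subv0.
  apply/subvP => _ /memv_imgP[S _ ->].
  by rewrite AE iter_ad_nilpotent // mem0v.
have nil_e0'' : nilpotent_mx e0'' by apply: e_nil; case: L_varpi2.
pose R k := \rank (e0 ^+ k); pose R'' k := \rank (e0'' ^+ k).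
have rE m : (0 < m)%N -> (num_jordan_blocks m e0 + 2 * R m = R m.-1 + R m.+1)%N.
  exact: num_jordan_blocks_ranks.
have r''E m : (0 < m)%N -> (num_jordan_blocks m e0'' + 2 * R'' m = R'' m.-1 + R''
  m.+1)%N.
  exact: num_jordan_blocks_ranks.
have R_eq k T : T \in pp -> \tr T != 0 -> iter k (ad e) T = 0 -> R'' k = R k.
  have [A AE] := AkE k.
  exact: (rank_expr_eq J_alt J_nondeg two_neq0 B_basis n_ge4 L_varpi2 e_lie ppE P0E AE).
have R_succ k (A : 'End('M[K]_n)) : (forall S, A S = iter k (ad e) S) ->
    (exists2 T, T \in pp & \tr T != 0) ->
    (forall T, T \in pp -> iter k (ad e) T = 0 -> \tr T = 0) ->
    (R'' k + (1%:M \in A @: P0)%VS + 1 = R k)%N.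
  move=> AE.
  exact: (rank_expr_succ J_alt J_nondeg two_neq0 B_basis n_ge4 L_varpi2 e_lie ppE P0E
    AE).
have pp1 : 1%:M \in pp by apply/ppE; rewrite form_adj1.
have [p_n|ndvd_n] := boolP (p %| n)%N; last first.
  (* Here the identity has nonzero trace and is killed by [ad e], so it plays the role of T for
     every k > 0. *)
  have tr1 : \tr (1%:M : 'M[K]_n) != 0 by rewrite mxtrace1 -(dvdn_pcharf charK).
  have R_gt0 k : (0 < k)%N -> R'' k = R k.
    case: k => // k _; apply: (R_eq _ 1%:M) => //.
    by rewrite iterSr /ad mulmx1 mul1mx subrr iter_ad0.
  have R0 : (R'' 0 + 1 = R 0)%N.
    have [A AE] := AkE 0%N; rewrite -(R_succ 0%N A AE); last first.
    - by move=> T _ /= ->; rewrite mxtrace0.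
    - by exists 1%:M.
    rewrite (_ : (1%:M \in _) = false) ?addn0 //.
    apply: contra_neqF tr1 => /memv_imgP[S /P0E[_ trS]].
    by rewrite AE /= => ->.
  have [k|k|/(_ isT) r1 _ r_eq] := second_difference_step (c := 1) (q := 1) rE r''E.
  - by rewrite ltnS leqn0 => /eqP ->.
  - exact: R_gt0.
  split=> // _; split; first by rewrite /r -r1 PoszD addrK.
  by move=> m m_gt0 m_neq1; rewrite /r'' r_eq // => m0; rewrite m0 in m_gt0.
have [T [ppT trT qT]] : exists T, [/\ T \in pp, \tr T != 0 & iter q (ad e) T = 0].
  (* The block size x was chosen with x / q prime to p, so the trace x / q is nonzero in K. *)
  have [T Tq trT] := jordan_commuting_trace q_gt0 d_e d_x (allP dvd_q _ d_x).
  exists (2%:R^-1 *: (T + form_adj J T)); split=> //.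
    by rewrite tr_half trT -(dvdn_pcharf charK).
  rewrite ad_half (iter_ad_pchar _ _ _ charK) // /ad Tq subrr.
  by rewrite /form_adj trmx0 mulmx0 mul0mx addr0 scaler0.
have R_ge k : (q <= k)%N -> R'' k = R k.
  move=> le_qk; apply: (R_eq _ T) => //.
  by rewrite -(subnK le_qk) iterD qT iter_ad0.
have R_lt k : (k < q)%N -> (R'' k + 2 = R k)%N.
  (* [S] serves twice: pairing with it shows that the kernel of (ad e)^k has trace zero, and its
     average with its adjoint puts 1 in the image of P0. *)
  move=> lt_kq; have [S adS trS] := jordan_ad_one charK d_e dvd_q lt_kq.
  have [A AE] := AkE k; rewrite -(R_succ k A AE); last first.
  - by move=> U _ kU; rewrite -[U]mulmx1 -adS tr_mul_iter_ad kU mul0mx mxtrace0 mulr0.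
  - by exists T.
  suff -> : (1%:M \in A @: P0)%VS by rewrite -addnA.
  pose S' := 2%:R^-1 *: (S + form_adj J S).
  have -> : 1%:M = A S' by rewrite AE ad_half adS form_adj1 // half.
  apply/memv_img/P0E; split; first exact/ppE/pp_half.
  (* For k = 0 the solution is S = 1, whose trace n vanishes in K. *)
  rewrite tr_half; case: (posnP k) => [k0|]; last exact: trS.
  by move: adS; rewrite k0 /= => ->; rewrite mxtrace1; apply/eqP;
    rewrite -(dvdn_pcharf charK).
have [r_q r_q1 r_eq] := second_difference_step rE r''E R_lt R_ge.
have r''_q : r'' q = r q - 2 by rewrite /r -r_q // PoszD addrK.
split=> // _ alpha0.
  have q1 : q = 1%N by rewrite /q alpha0.
  split; first by move: r''_q; rewrite q1.
  move=> m m_gt0 m_neq1; rewrite /r'' r_eq ?q1 // => m0.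
  by rewrite m0 in m_gt0.
have q_gt2 : (2 < q)%N.
  by apply: (leq_trans p_gt2); rewrite -[leqLHS]expn1 leq_exp2l // ltnW.
split=> // [|m m_gt0 neq_q neq_q1]; last by rewrite /r'' r_eq.
have [D De _] := jordan_ad_one charK d_e dvd_q (ltnW q_gt2).
rewrite /r'' r_q1 ?(ltnW q_gt2) //.
rewrite (num_jordan_blocks_eq0 charK nil_e0 (ad_differential_ext2 two_neq0 De)) //.
(* p divides q because alpha > 0, so p dividing q - 1 would divide 1. *)
apply: contraL (prime_gt1 p_pr) => p_q1; rewrite -leqNgt dvdn_leq //.
by rewrite -(dvdn_addr 1 p_q1) subnK // /q -(prednK alpha0) expnS dvdn_mulr.
Qed.
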